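(* Let $D\in\{D_4,E_6,E_7,E_8\}$, $q\in\mathbb{C}^*$ and $t\in\mathbb{T}$. The Gelfand–Kirillov dimension of $\mathbf{H}(q)$ as an algebra over $\mathbb{C}[\mathbb{T}]$, and the Gelfand–Kirillov dimension of $H(t,q)$ (over $\mathbb{C}$), are equal to $2$.
   Context: To $D$ attach integers $m$ and $(d_1,\dots,d_m)$: for $D_4$, $m=4$ and $(2,2,2,2)$; for $E_6$, $m=3$ and $(3,3,3)$; for $E_7$, $m=3$ and $(2,4,4)$; for $E_8$, $m=3$ and $(2,3,6)$. $\mathbb{T}$ is the algebraic torus of collections $t=(t_{kj})$, $1\le k\le m$, $1\le j\le d_k$, of nonzero complex numbers with $\prod_j t_{kj}=1$ for all $k$; $u_{kj}=e^{2\pi\mathrm{i}j/d_k}t_{kj}$. For $q\in\mathbb{C}^*$ and $t\in\mathbb{T}$, $H(t,q)$ is the $\mathbb{C}$-algebra generated by $T_1,\dots,T_m$ with defining relations $\prod_{j=1}^{d_k}(T_k-u_{kj})=0$ ($k=1,\dots,m$), $T_1\cdots T_m=q$. $\mathbf{H}(q)$ is the $\mathbb{C}[\mathbb{T}]$-algebra defined by the same generators and relations, with the $t_{kj}$ regarded as the coordinate functions in $\mathbb{C}[\mathbb{T}]$ (central elements). For $\mathbf{H}(q)$, growth is measured by ranks of $\mathbb{C}[\mathbb{T}]$-modules. *)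

(* Defs.v *)
From HB Require Import structures.
From mathcomp Require Import all_boot all_order all_algebra.
From mathcomp Require Import complex.
From mathcomp Require Import all_classical all_reals all_analysis.
(* The notations of monalg clash with those of MathComp-Analysis. *)
From mathcomp Require Import -(notations) monalg.

Set Implicit Arguments.
Unset Strict Implicit.
Unset Printing Implicit Defensive.

Import Order.TTheory GRing.Theory Num.Theory.
Import numFieldNormedType.Exports.

Local Open Scope classical_set_scope.
Local Open Scope ring_scope.
Local Open Scope quotient_scope.

(* A unital associative algebra over k: a ring with a morphism from k to its
   centre.  MathComp's algType requires 1 != 0, but an algebra given by
   generators and relations may a priori be zero. *)
Record algebra (k : comNzRingType) := Algebra {
  alg_ring :> pzRingType;
  alg_scalar : {rmorphism k -> alg_ring};
  alg_scalarC : forall a x, alg_scalar a * x = x * alg_scalar a }.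

Section GelfandKirillov.
Variables (R : realType) (k : comNzRingType) (A : algebra k).

Definition alg_scale (a : k) (x : A) : A := alg_scalar A a * x.

Definition lin_indep n (v : 'I_n -> A) : Prop :=
  forall c : 'I_n -> k, \sum_i alg_scale (c i) (v i) = 0 -> forall i, c i = 0.

Definition lin_span (X : set A) : set A :=
  [set x | exists n (c : 'I_n -> k) (v : 'I_n -> A),
     (forall i, X (v i)) /\ x = \sum_i alg_scale (c i) (v i)].

(* The rank of a submodule N over the domain k is dim_K (K (x)_k N) with K the
   fraction field of k, that is, the supremum of the sizes of the linearly
   independent families in N; for k a field it is the dimension of N. *)
Definition rank (N : set A) : \bar R :=
  ereal_sup [set n%:R%:E | n in
    [set n | exists v : 'I_n -> A, (forall i, N (v i)) /\ lin_indep v]].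

(* V^0 + V^1 + ... + V^n, for V the submodule spanned by s *)
Definition filt_span (s : seq A) (n : nat) : set A :=
  lin_span [set x | exists w : seq A,
    [/\ (size w <= n)%N, {subset w <= s} & x = \prod_(y <- w) y]].

Definition growth_exponent (s : seq A) : \bar R :=
  limn_esup (fun n => lne (rank (filt_span s n)) * ((ln n%:R)^-1)%:E)%E.

(* The supremum over all finitely generated submodules V; it is -oo for the
   zero algebra. *)
Definition GKdim : \bar R := ereal_sup (range growth_exponent).

End GelfandKirillov.

Section QuotientRing.
Variables (A : pzRingType) (X : set A).

Inductive ideal_gen : A -> Prop :=
| ideal_gen_in x : X x -> ideal_gen x
| ideal_gen0 : ideal_gen 0
| ideal_genD x y : ideal_gen x -> ideal_gen y -> ideal_gen (x + y)
| ideal_genMl a x : ideal_gen x -> ideal_gen (a * x)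
| ideal_genMr a x : ideal_gen x -> ideal_gen (x * a).

Lemma ideal_genN x : ideal_gen x -> ideal_gen (- x).
Proof. by move=> Ix; rewrite -mulN1r; exact: ideal_genMl. Qed.

Definition ideal_eqv (x y : A) : bool := `[< ideal_gen (x - y) >].

Lemma ideal_eqv_refl : reflexive ideal_eqv.
Proof. by move=> x; apply/asboolP; rewrite subrr; exact: ideal_gen0. Qed.

Lemma ideal_eqv_sym : symmetric ideal_eqv.
Proof.
by move=> x y; apply/asboolP/asboolP => /ideal_genN; rewrite opprB.
Qed.

Lemma ideal_eqv_trans : transitive ideal_eqv.
Proof.
move=> y x z /asboolP Ixy /asboolP Iyz; apply/asboolP.
by rewrite -(subrKA y x (- z)); exact: ideal_genD.
Qed.

Canonical ideal_equiv :=
  EquivRel ideal_eqv ideal_eqv_refl ideal_eqv_sym ideal_eqv_trans.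
Canonical ideal_encModRel := defaultEncModRel ideal_eqv.

Definition quot_ring := {eq_quot ideal_eqv}.
HB.instance Definition _ := Choice.on quot_ring.
HB.instance Definition _ := EqQuotient.on quot_ring.

Lemma quot_ringP (x y : A) :
  \pi_quot_ring x = \pi_quot_ring y <-> ideal_gen (x - y).
Proof. by split=> [/eqmodP/asboolP|?] //; apply/eqmodP/asboolP. Qed.

Lemma quot_repr (x : A) : ideal_gen (repr (\pi_quot_ring x) - x).
Proof. by apply/quot_ringP; rewrite reprK. Qed.

Definition quot_zero : quot_ring := lift_cst quot_ring 0.
Definition quot_one : quot_ring := lift_cst quot_ring 1.
Definition quot_opp := lift_op1 quot_ring (-%R : A -> A).
Definition quot_add := lift_op2 quot_ring (+%R : A -> A -> A).
Definition quot_mul := lift_op2 quot_ring ( *%R : A -> A -> A).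

Canonical pi_quot_zero_morph := PiConst quot_zero.
Canonical pi_quot_one_morph := PiConst quot_one.

Lemma pi_quot_opp : {morph \pi_quot_ring : x / - x >-> quot_opp x}.
Proof.
move=> x; unlock quot_opp; apply/quot_ringP.
rewrite opprK addrC; exact: quot_repr.
Qed.
Canonical pi_quot_opp_morph := PiMorph1 pi_quot_opp.

Lemma pi_quot_add : {morph \pi_quot_ring : x y / x + y >-> quot_add x y}.
Proof.
move=> x y; unlock quot_add; apply/esym/quot_ringP; rewrite opprD addrACA.
by apply: ideal_genD; exact: quot_repr.
Qed.
Canonical pi_quot_add_morph := PiMorph2 pi_quot_add.

Lemma pi_quot_mul : {morph \pi_quot_ring : x y / x * y >-> quot_mul x y}.
Proof.
move=> x y; unlock quot_mul; apply/esym/quot_ringP.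
rewrite -(subrKA (repr (\pi_quot_ring x) * y)) -mulrBr -mulrBl.
apply: ideal_genD.
  by apply: ideal_genMl; exact: quot_repr.
by apply: ideal_genMr; exact: quot_repr.
Qed.
Canonical pi_quot_mul_morph := PiMorph2 pi_quot_mul.

Lemma quot_addA : associative quot_add.
Proof. by do 3![elim/quotW=> ?]; rewrite !piE addrA. Qed.
Lemma quot_addC : commutative quot_add.
Proof. by do 2![elim/quotW=> ?]; rewrite !piE addrC. Qed.
Lemma quot_add0 : left_id quot_zero quot_add.
Proof. by elim/quotW=> ?; rewrite !piE add0r. Qed.
Lemma quot_addN : left_inverse quot_zero quot_opp quot_add.
Proof. by elim/quotW=> ?; rewrite !piE addNr. Qed.

HB.instance Definition _ :=
  GRing.isZmodule.Build quot_ring quot_addA quot_addC quot_add0 quot_addN.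

Lemma quot_mulA : associative quot_mul.
Proof. by do 3![elim/quotW=> ?]; rewrite !piE mulrA. Qed.
Lemma quot_mul1l : left_id quot_one quot_mul.
Proof. by elim/quotW=> ?; rewrite !piE mul1r. Qed.
Lemma quot_mul1r : right_id quot_one quot_mul.
Proof. by elim/quotW=> ?; rewrite !piE mulr1. Qed.
Lemma quot_mulDl : left_distributive quot_mul quot_add.
Proof. by do 3![elim/quotW=> ?]; rewrite !piE mulrDl. Qed.
Lemma quot_mulDr : right_distributive quot_mul quot_add.
Proof. by do 3![elim/quotW=> ?]; rewrite !piE mulrDr. Qed.

HB.instance Definition _ := GRing.Zmodule_isPzRing.Build quot_ring
  quot_mulA quot_mul1l quot_mul1r quot_mulDl quot_mulDr.

Definition quot_proj (x : A) : quot_ring := \pi_quot_ring x.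

Lemma quot_proj_zmod : zmod_morphism quot_proj.
Proof. by move=> x y; rewrite /quot_proj -[y in RHS]opprK !piE opprK. Qed.

Lemma quot_proj_monoid : monoid_morphism quot_proj.
Proof. by split=> [|x y]; rewrite /quot_proj !piE. Qed.

HB.instance Definition _ :=
  GRing.isZmodMorphism.Build A quot_ring quot_proj quot_proj_zmod.
HB.instance Definition _ :=
  GRing.isMonoidMorphism.Build A quot_ring quot_proj quot_proj_monoid.

End QuotientRing.

Section FreeAlgebra.
Variables (k : comNzRingType) (m : nat).

Definition free_alg := malg (fmonom 'I_m) k.
HB.instance Definition _ := GRing.NzRing.on free_alg.

Definition free_scalar (a : k) : free_alg := mkmalgU (fmone 'I_m) a.
HB.instance Definition _ :=
  GRing.RMorphism.copy free_scalar (@mkmalgU (fmonom 'I_m) k (fmone 'I_m)).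

Lemma free_scalarC (a : k) (x : free_alg) :
  free_scalar a * x = x * free_scalar a.
Proof.
rewrite [LHS]fgmulUg [RHS]fgmulgU; apply: eq_bigr => w _.
by rewrite mulrC mul1m mulm1.
Qed.

Definition free_gen (i : 'I_m) : free_alg := mkmalgU (fmu i) 1.

End FreeAlgebra.

Section GDAHA.
Variables (k : comNzRingType) (m : nat) (d : 'I_m -> nat).
Variables (u : forall i, 'I_(d i) -> k) (q : k).

Local Notation T i := (free_gen k i).

Definition gdaha_rel : set (free_alg k m) :=
  [set x | (exists i, x = \prod_(j < d i) (T i - free_scalar m (u j))) \/
           x = \prod_i T i - free_scalar m q].

Definition gdaha_scalar : {rmorphism k -> quot_ring gdaha_rel} :=
  quot_proj gdaha_rel \o free_scalar m.

Lemma gdaha_scalarC a x : gdaha_scalar a * x = x * gdaha_scalar a.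
Proof.
rewrite -[x]reprK -[\pi_(quot_ring gdaha_rel) _]/(quot_proj gdaha_rel _) /=.
by rewrite -!rmorphM free_scalarC.
Qed.

Definition gdaha : algebra k := Algebra gdaha_scalarC.

End GDAHA.

Inductive diagram := D4 | E6 | E7 | E8.

Definition legs (D : diagram) : seq nat :=
  match D with
  | D4 => [:: 2; 2; 2; 2]
  | E6 => [:: 3; 3; 3]
  | E7 => [:: 2; 4; 4]
  | E8 => [:: 2; 3; 6]
  end%N.

Definition nlegs (D : diagram) : nat := size (legs D).

Definition leg (D : diagram) (i : 'I_(nlegs D)) : nat := nth 0%N (legs D) i.

Section Torus.
Variables (R : realType) (D : diagram).
Notation C := R[i].

Record torus := Torus {
  tcoord :> forall i : 'I_(nlegs D), 'I_(leg i) -> C;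
  tcoord_neq0 : forall i j, @tcoord i j != 0;
  tcoord_prod : forall i, \prod_j @tcoord i j = 1 }.

HB.instance Definition _ := gen_eqMixin torus.
HB.instance Definition _ := gen_choiceMixin torus.

Lemma torus1_prod (i : 'I_(nlegs D)) : \prod_(j < leg i) (1 : C) = 1.
Proof. by rewrite big1. Qed.

Definition torus1 : torus :=
  @Torus (fun _ _ => 1) (fun _ _ => oner_neq0 C) torus1_prod.

HB.instance Definition _ := isPointed.Build torus torus1.

(* The coordinate ring C[T], as the ring of polynomial functions on T; the
   inverses of the t_ij are among them because \prod_j t_ij = 1. *)
Inductive regular_fun : (torus -> C) -> Prop :=
| regular_cst (c : C) : regular_fun (fun=> c)
| regular_coord i (j : 'I_(leg i)) : regular_fun (fun t => t i j)
| regular_add f g : regular_fun f -> regular_fun g -> regular_fun (f + g)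
| regular_mul f g : regular_fun f -> regular_fun g -> regular_fun (f * g).

Definition regularb : pred (torus -> C) := fun f => `[< regular_fun f >].

Lemma regular_subring : subring_closed regularb.
Proof.
split.
- by apply/asboolP; exact: regular_cst.
- move=> f g /asboolP rf /asboolP rg; apply/asboolP.
  apply: regular_add => //; rewrite -mulN1r; apply: regular_mul => //.
  exact: (regular_cst (- 1)).
- by move=> f g /asboolP rf /asboolP rg; apply/asboolP; exact: regular_mul.
Qed.

HB.instance Definition _ :=
  GRing.isSubringClosed.Build _ regularb regular_subring.

Definition coord_ring := {f : torus -> C | regularb f}.
HB.instance Definition _ := SubChoice.on coord_ring.
HB.instance Definition _ := [SubChoice_isSubComNzRing of coord_ring by <:].

Definition coord_cst (c : C) : coord_ring :=
  exist regularb _ (asboolT (regular_cst c)).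
Definition coord_fun i (j : 'I_(leg i)) : coord_ring :=
  exist regularb _ (asboolT (regular_coord j)).

Definition expi (x : R) : C := (cos x +i* sin x)%C.

(* exp(2 pi i j / d_i) for j = 1, ..., d_i; the element j : 'I_(d_i) stands for
   the index j.+1. *)
Definition root_of_leg (i : 'I_(nlegs D)) (j : 'I_(leg i)) : C :=
  expi (2 * pi * j.+1%:R / (leg i)%:R).

Definition H (t : torus) (q : C) : algebra C :=
  gdaha (fun i (j : 'I_(leg i)) => root_of_leg j * t i j) q.

Definition bfH (q : C) : algebra coord_ring :=
  gdaha (fun i (j : 'I_(leg i)) => coord_cst (root_of_leg j) * coord_fun j)
        (coord_cst q).

End Torus.

(* Main.v *)
Require Import Defs.
From HB Require Import structures.
From mathcomp Require Import all_boot all_order all_algebra.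
From mathcomp Require Import finmap complex.
From mathcomp Require Import all_classical all_reals all_analysis.
From mathcomp Require Import -(notations) monalg.
From mathcomp Require Import zify lra.

Set Implicit Arguments.
Unset Strict Implicit.
Unset Printing Implicit Defensive.

Import Order.TTheory GRing.Theory Num.Theory.

(** The algebra is a deformation of a twisted group algebra of the rotation
    subgroup of an affine reflection group W acting on the plane: the product of
    two infinite dihedral groups for D_4, and the affine Weyl groups of types
    A_2, C_2, G_2 for E_6, E_7, E_8.  Number the walls of the fundamental alcove
    cyclically, so that walls l and l+1 meet at angle pi/d_l, and let s_l be the
    reflection in wall l.  Writing T_l = s_l s_{l+1} turns T_1 ... T_m = q into
    s_l s_l = 1 (up to a factor q at the last generator), and the polynomial
    equation of T_l into a deformed braid relation: it expresses one of the two
    alternating words of length d_l in s_l and s_{l+1} as an invertible multiple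
    of the other one plus shorter alternating words.

    The theorem follows from a basis theorem, valid over any nonzero commutative ring
    k as soon as q and the eigenvalues u_kj are invertible: [gdaha] is a free
    k-module on the alcoves of even length.  To prove it, reflection operators
    are constructed on the free k-module on all alcoves, by recursion on the
    length.  An alcove separated from the fundamental one by two walls is the
    top of exactly one finite dihedral coset, because three walls never separate
    at once; so exactly one relation has to be solved there, for one unknown
    with invertible coefficient, and no obstruction can occur ([climbP],
    [op_controlled], [op_relation]).  Since the relations force the operators,
    this module is universal ([compatible_all]), and it maps to two copies of
    the algebra exchanged by the s_l ([gop_relation]).  Conversely the algebra
    acts on the even part of the module ([act_rel]), where a reduced word
    applied to the fundamental alcove is exactly a basis vector
    ([gdaha_act_word]), hence the independence of the reduced words
    ([words_lin_indep]).

    Multiplication by a fixed element raises the length by a bounded amount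
    ([filt_span_filtration]), and the number of alcoves of length at most n lies
    between two multiples of n^2 ([even_alcoves], [filtration_span]).  As the
    size of an independent family is at most that of a spanning one over any
    nonzero commutative ring ([row_injective_leq]), the ranks grow quadratically for any
    such k ([GKdim_gdaha]), in particular for the coordinate ring of the torus
    and for the field of complex numbers. *)

(** * Alcoves and their length *)

(** All rank two statements concern two cyclically consecutive walls; naming
    them by a bit makes alternation a negation. *)
Definition letter m (r : bool) (l : 'I_m) : 'I_m := if r then l else ordS l.

Section Alternate.
Variables (m : nat) (W : Type) (refl : 'I_m -> W -> W).

Fixpoint alternate (r : bool) (l : 'I_m) (n : nat) (w : W) : W :=
  if n is n'.+1 then refl (letter (r (+) odd n') l) (alternate r l n' w) else w.

Lemma alternateSr r l n w :
  alternate r l n.+1 w = alternate (~~ r) l n (refl (letter r l) w).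
Proof.
elim: n => [|n IHn]; first by rewrite /= addbF.
by rewrite -[LHS]/(refl _ (alternate r l n.+1 w)) IHn /= addbN addNb.
Qed.

Lemma alternate_last r l n w : (0 < n)%N ->
  alternate r l n w =
  refl (letter (r (+) odd n.-1) l) (alternate r l n.-1 w).
Proof. by case: n. Qed.

(** The inverse of an alternating word is the alternating word that starts with
    its last letter. *)
Lemma alternateK (reflK : forall i, involutive (refl i)) r l n w :
  alternate (r (+) ~~ odd n) l n (alternate r l n w) = w.
Proof.
elim: n w => [//|n IHn] w.
rewrite alternateSr -[alternate r l n.+1 w]/(refl _ _) /= negbK reflK.
by rewrite -addbN IHn.
Qed.

End Alternate.

(** What the basis theorem uses of an affine reflection group acting simply
    transitively on its alcoves. [refl i] is the reflection in the i-th wall of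
    the fundamental alcove [base], and [desc i w] says that this wall separates
    w from [base]. Braid relations, of length [d l], are only required between
    the consecutive walls l and l + 1; two walls that both separate some w from
    [base] are consecutive, and no third wall separates w as well. The fields
    [gauge], [pos] and [grid] compare the length with coordinates in the plane,
    which yields the two bounds of quadratic growth. *)
Record alcoves (m : nat) (d : 'I_m -> nat) := Alcoves {
  alc :> choiceType;
  base : alc;
  refl : 'I_m -> alc -> alc;
  desc : 'I_m -> alc -> bool;
  gauge : alc -> nat;
  margin : nat;
  reflK : forall i, involutive (refl i);
  desc_refl : forall i w, desc i (refl i w) = ~~ desc i w;
  desc_base : forall w, (forall i, ~~ desc i w) -> w = base;
  gauge_desc : forall i w, desc i w ->
    (gauge (refl i w) < gauge w <= gauge (refl i w) + margin)%N;
  desc_adj : forall i j w, i != j -> desc i w -> desc j w ->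
    (j == ordS i) || (i == ordS j);
  desc_two : forall j l w, desc l w -> desc (ordS l) w -> desc j w ->
    (j == l) || (j == ordS l);
  alternate_up : forall l w, ~~ desc l w -> ~~ desc (ordS l) w ->
    forall r n, (n < d l)%N ->
    ~~ desc (letter (r (+) odd n) l) (alternate refl r l n w);
  alternate_down : forall l w, desc l w -> desc (ordS l) w ->
    forall r n, (n < d l)%N ->
    desc (letter (r (+) odd n) l) (alternate refl r l n w);
  braid : forall l r w,
    alternate refl r l (d l) w = alternate refl (~~ r) l (d l) w;
  order_gt0 : forall l, (0 < d l)%N;
  ordS_neq : forall l : 'I_m, (ordS l == l) = false;
  ordSS_neq : forall l : 'I_m, (ordS (ordS l) == l) = false;
  pos : alc -> int * int;
  pos_inj : injective pos;
  pos_gauge : forall w, (`|(pos w).1| <= gauge w + margin)%N /\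
                        (`|(pos w).2| <= gauge w + margin)%N;
  grid : nat * nat -> alc;
  grid_inj : injective grid;
  gauge_grid : forall a b, (gauge (grid (a, b)) <= margin * (a + b + 1))%N }.

Section Length.
Variables (m : nat) (d : 'I_m -> nat) (W : alcoves d).
Implicit Types (w v u : W) (i j l : 'I_m).
Local Notation alt := (alternate (@refl _ _ W)).

(** Choosing one descent everywhere selects one reduced word for every alcove.
    *)
Definition pref w := [pick i | desc i w].

Lemma prefP w i : pref w = Some i -> desc i w.
Proof. by rewrite /pref; case: pickP => // j dj [<-]. Qed.

Fixpoint len_rec n w : nat :=
  if n is n'.+1 then
    if pref w is Some i then (len_rec n' (refl i w)).+1 else 0
  else 0.

(** The fuel is large enough since [gauge] decreases along descents. *)
Definition len w := len_rec (gauge w) w.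

Lemma len_recE n w : (gauge w <= n)%N -> len_rec n w = len w.
Proof.
rewrite /len; elim: n {-2}n (leqnn n) w => [|N IHN] n len w lew.
  have -> : n = 0%N by lia.
  by have -> : gauge w = 0%N by lia.
case: n len lew => [|n] ltnN lew; first by have -> : gauge w = 0%N by lia.
case Ew: (gauge w) => [|p] /=; case Ep: (pref w) => [i|//].
  by have /prefP/gauge_desc/andP[] := Ep; rewrite Ew.
have /prefP/gauge_desc/andP[ltw _] := Ep.
have lep : (gauge (refl i w) <= p)%N by rewrite -ltnS -Ew.
by rewrite (IHN n) ?(IHN p) //; lia.
Qed.

Lemma len_pref w i : pref w = Some i -> len w = (len (refl i w)).+1.
Proof.
move=> Ep; have /prefP/gauge_desc/andP[ltw _] := Ep.
by rewrite -(len_recE (leqnSn (gauge w))) /= Ep len_recE // ltnW.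
Qed.

Lemma two_letters i j w : i != j -> desc i w -> desc j w ->
  exists l r, i = letter r l /\ j = letter (~~ r) l.
Proof.
move=> ij di dj; case/orP: (desc_adj ij di dj) => /eqP e.
  by exists i, true; rewrite /letter /= e.
by exists j, false; rewrite /letter /= e.
Qed.

Lemma letter_desc l r w : desc (letter r l) w -> desc (letter (~~ r) l) w ->
  desc l w /\ desc (ordS l) w.
Proof. by case: r. Qed.

(** Independent of the chosen descent: when i and the chosen descent differ, the
    two alternating words starting with them lead down to the same alcove in the
    same number of steps. *)
Lemma len_desc i w : desc i w -> len w = (len (refl i w)).+1.
Proof.
elim: (gauge w).+1 {-2}w (ltnSn (gauge w)) i => // {}N IHN {}w lewN i di.
case Ep: (pref w) => [j|]; last first.
  by move: Ep; rewrite /pref; case: pickP => // /(_ i); rewrite di.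
have dj := prefP Ep; have [->|ij] := eqVneq i j; first exact: len_pref.
have [l [r [ei ej]]] := two_letters ij di dj; subst i j.
have [dl dl'] := letter_desc di dj.
have down s n : (n < d l)%N ->
   (gauge (alt s l n.+1 w) < gauge w)%N /\
   (len (alt s l 1 w) = len (alt s l n.+1 w) + n)%N.
  elim: n => [|n IHn] ltnd.
    split; last by rewrite addn0.
    by case/andP: (gauge_desc (alternate_down dl dl' s ltnd)).
  have [|g1 e1] := IHn; first lia.
  have d1 := alternate_down dl dl' s ltnd.
  have /andP[g2 _] := gauge_desc d1; split; first exact: ltn_trans g2 g1.
  rewrite e1 (IHN _ _ _ d1) ?addSnnS //; lia.
have dpos := order_gt0 W l.
have last s : (len (refl (letter s l) w) = len (alt s l (d l) w) + (d l).-1)%N.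
  have [|_] := down s (d l).-1; first by lia.
  by rewrite prednK //= addbF.
by rewrite (len_pref Ep) !last [in RHS]braid.
Qed.

Lemma len_asc i w : ~~ desc i w -> len (refl i w) = (len w).+1.
Proof. by move=> ni; rewrite (@len_desc i) ?reflK // desc_refl. Qed.

Lemma len0 w : len w = 0 -> w = base W.
Proof.
move=> l0; apply: desc_base => i; apply/negP => di.
by move: (len_desc di); rewrite l0.
Qed.

Lemma desc_base_false i : desc i (base W) = false.
Proof.
apply/negP=> di0.
suff: forall n w, (gauge w < n)%N -> False by move/(_ _ _ (ltnSn (gauge (base W)))).
elim=> // n IHn w lew.
case Ep: (pref w) => [j|].
  by have /andP[lt _] := gauge_desc (prefP Ep); apply: (IHn (refl j w)); lia.
move: Ep; rewrite /pref; case: pickP => // nd _.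
by have := desc_base (fun i => negbT (nd i)) => eb; move: (nd i); rewrite eb di0.
Qed.

Lemma len_base : len (base W) = 0.
Proof.
rewrite /len; case: (gauge _) => //= n; rewrite /pref; case: pickP => // i.
by rewrite desc_base_false.
Qed.

Lemma prefN w : pref w = None -> w = base W.
Proof.
rewrite /pref; case: pickP => // nd _.
by apply: desc_base => i; rewrite nd.
Qed.

Lemma len_refl_le i w : (len (refl i w) <= (len w).+1)%N.
Proof.
by have [/len_desc ->|/len_asc ->] := boolP (desc i w); [lia|].
Qed.

Lemma odd_len i w : odd (len (refl i w)) = ~~ odd (len w).
Proof.
by have [/len_desc ->|/len_asc ->] //= := boolP (desc i w); rewrite negbK.
Qed.

Lemma len_gauge w : (len w <= gauge w)%N.
Proof.
have le n v : (len_rec n v <= n)%N.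
  by elim: n v => // n IHn v /=; case: (pref v) => // i; apply: IHn.
exact: le.
Qed.

Lemma gauge_len w : (gauge w <= gauge (base W) + margin W * len w)%N.
Proof.
elim: (len w) {-2}w (erefl (len w)) => [|n IHn] {}w lw.
  by rewrite (len0 lw) leq_addr.
case Ep: (pref w) => [j|]; last by move: lw; rewrite (prefN Ep) len_base.
move: lw; rewrite (len_pref Ep) => -[/IHn].
have /andP[_ le] := gauge_desc (prefP Ep) => le'.
by apply: leq_trans le _; rewrite mulnS [(margin W + _)%N]addnC addnA leq_add2r.
Qed.

Lemma len_alternate_up l u r n : ~~ desc l u -> ~~ desc (ordS l) u ->
  (n <= d l)%N -> len (alt r l n u) = (len u + n)%N.
Proof.
move=> nl nl'; elim: n => [|n IHn] len; first by rewrite addn0.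
have /len_asc/= -> := alternate_up nl nl' r len.
by rewrite IHn ?addnS // ltnW.
Qed.

(** If l and l + 1 are both descents of v, this is the shortest element of its
    coset under the dihedral group that they generate. *)
Definition bottom l v := alt true l (d l) v.

Lemma bottomP l v : desc l v -> desc (ordS l) v ->
  [/\ ~~ desc l (bottom l v), ~~ desc (ordS l) (bottom l v),
      forall r, alt r l (d l) (bottom l v) = v &
      len v = (len (bottom l v) + d l)%N].
Proof.
move=> dl dl'; have dpos := order_gt0 W l.
have botE r : bottom l v = alt r l (d l) v by case: r => //; exact: (braid l true v).
have nd r : ~~ desc (letter r l) (bottom l v).
  have lt : ((d l).-1 < d l)%N by lia.
  have := alternate_down dl dl' (r (+) odd (d l).-1) lt.
  rewrite (botE (r (+) odd (d l).-1)) addbK -{4}(prednK dpos) /= addbK.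
  by rewrite desc_refl => ->.
have up r : alt r l (d l) (bottom l v) = v.
  rewrite (botE (r (+) ~~ odd (d l))) -{1}(addbK (~~ odd (d l)) r).
  by rewrite alternateK // => i; apply: reflK.
split=> //; [exact: (nd true)|exact: (nd false)|].
by rewrite -(len_alternate_up true (nd true) (nd false) (leqnn _)) up.
Qed.

End Length.

Local Open Scope ring_scope.

(** * Invertible elements and free modules *)

(** Inverses are chosen classically because the scalars are an arbitrary
    commutative ring, in particular the coordinate ring of the torus. *)
Definition unital (k : comNzRingType) (a : k) := exists b, a * b = 1.
Definition partial_inv (k : comNzRingType) (a : k) : k :=
  xget 0 [set b | a * b = 1]%classic.

Lemma partial_invP (k : comNzRingType) (a : k) :
  unital a -> a * partial_inv a = 1.
Proof. by case=> b ab; exact: (@xgetPex _ 0 [set b | a * b = 1]%classic (ex_intro _ b ab)). Qed.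

Lemma unital_inv (k : comNzRingType) (a : k) : unital a -> unital (partial_inv a).
Proof. by move=> /partial_invP ua; exists a; rewrite mulrC. Qed.

Lemma unitalM (k : comNzRingType) (a b : k) : unital a -> unital b -> unital (a * b).
Proof. by move=> [a' aa] [b' bb]; exists (a' * b'); rewrite mulrACA aa bb mulr1. Qed.

Lemma unitalN (k : comNzRingType) (a : k) : unital a -> unital (- a).
Proof. by move=> [a' aa]; exists (- a'); rewrite mulrNN. Qed.

Lemma unital1 (k : comNzRingType) : unital (1 : k).
Proof. by exists 1; rewrite mulr1. Qed.

Section LinearExtension.
Variables (k : comNzRingType) (K : choiceType) (N : lmodType k).
Implicit Types (f : K -> N) (y : malg K k).

Definition lext f y : N := \sum_(w <- msupp y) mcoeff w y *: f w.

Lemma lextEw (E : {fset K}) f y : (msupp y `<=` E)%fset ->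
  lext f y = \sum_(w <- E) mcoeff w y *: f w.
Proof.
move=> le; rewrite [LHS](big_fset_incl _ le) => //= x xd /mcoeff_outdom ->.
by rewrite scale0r.
Qed.

Lemma lext_linear f : linear (lext f).
Proof.
move=> a y z; pose E := (msupp y `|` msupp z)%fset.
have ysub : (msupp y `<=` E)%fset by exact: fsubsetUl.
have zsub : (msupp z `<=` E)%fset by exact: fsubsetUr.
have azsub : (msupp (a *: y + z) `<=` E)%fset.
  apply: fsubset_trans (msuppD_le _ _) _.
  by apply: fsetSU; exact: msuppZ_le.
rewrite !(@lextEw E) // scaler_sumr -big_split /=; apply: eq_bigr => w _.
by rewrite mcoeffD mcoeffZ scalerDl scalerA.
Qed.

HB.instance Definition _ f :=
  GRing.isLinear.Build k (malg K k) N *:%R (lext f) (lext_linear f).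

Definition basis_vector (w : K) : malg K k := mkmalgU w 1.

Lemma mcoeff_basis w w' : mcoeff w' (basis_vector w) = (w == w')%:R.
Proof. by rewrite mcoeffU. Qed.

Lemma lext_basis f w : lext f (basis_vector w) = f w.
Proof. by rewrite (lextEw _ msuppU_le) big_seq_fset1 mcoeffUU scale1r. Qed.

Lemma lext_ind (S : N -> Prop) f y :
    S 0 -> (forall x z, S x -> S z -> S (x + z)) ->
    (forall (a : k) x, S x -> S (a *: x)) ->
  (forall w, mcoeff w y != 0 -> S (f w)) -> S (lext f y).
Proof.
move=> S0 SD SZ Sf; rewrite /lext big_seq; elim/big_ind: _ => // w wy.
by apply/SZ/Sf; rewrite mcoeff_neq0.
Qed.

Lemma eq_lext f g y : (forall w, mcoeff w y != 0 -> f w = g w) -> lext f y = lext g y.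
Proof.
move=> fg; rewrite /lext !big_seq; apply: eq_bigr => w wy.
by rewrite fg // mcoeff_neq0.
Qed.

(** Separates the leading term of y from the rest. *)
Lemma lext_split f y (c : k) w : lext f y = c *: f w + lext f (y - c *: basis_vector w).
Proof. by rewrite linearB linearZ /= lext_basis subrKC. Qed.

End LinearExtension.

Lemma malg_basisE (k : comNzRingType) (K : choiceType) (y : malg K k) :
  y = lext (@basis_vector k K) y.
Proof.
rewrite {1}(monalgE y) /lext; apply: eq_bigr => w _.
by apply/malgP => w'; rewrite mcoeffZ !mcoeffU mulr_natr.
Qed.

Lemma lext_comp (k : comNzRingType) (K : choiceType) (N N' : lmodType k)
    (g : {linear N -> N'}) (f : K -> N) (y : malg K k) :
  g (lext f y) = lext (g \o f) y.
Proof.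
by rewrite /lext linear_sum; apply: eq_bigr => w _; rewrite linearZ.
Qed.

(** * Reflection operators on the free module on the alcoves *)

Section Relation.
Variables (k : comNzRingType) (m : nat) (d : 'I_m -> nat).
Variables (P : 'I_m -> {poly k}) (N : lmodType k) (o : bool -> 'I_m -> N -> N).

(** The analogue of [alternate] for operators that may depend on the parity of
    the vector they act on: the even and the odd part of a module are in general
    different spaces, which the reflections exchange. Starting from parity p,
    the words that begin with [letter p l] turn in the direction of the rotation
    s_l s_{l+1}, the others in the opposite direction. *)
Fixpoint chain (p r : bool) (l : 'I_m) (n : nat) (x : N) : N :=
  if n is n'.+1
  then o (p (+) odd n') (letter (r (+) odd n') l) (chain p r l n' x)
  else x.

(** The n-th power of the rotation, applied to the end of the longest backward
    word on x. Cancelling letters leaves an alternating word on x of length at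
    most [d l]. *)
Definition balanced p l n x : N :=
  if (n.*2 < d l)%N then chain p (~~ p) l (d l - n.*2) x
  else chain p p l (n.*2 - d l) x.

(** The equation P_l (s_l s_{l+1}) = 0 multiplied by a power of the rotation, so
    that only alternating words on x of length at most [d l] occur; the two
    longest ones have the extreme coefficients of P_l. *)
Definition dihedral_relation p l x : N :=
  \sum_(n < (d l).+1) (P l)`_n *: balanced p l n x.

Lemma chain_last p r l x : (0 < d l)%N ->
  chain p r l (d l) x = o (p (+) odd (d l).-1) (letter (r (+) odd (d l).-1) l)
                          (chain p r l (d l).-1 x).
Proof. by move=> dpos; rewrite -{1}(prednK dpos). Qed.

Lemma balanced_end p r l x : (0 < d l)%N ->
  balanced p l (if p == r then d l else 0%N) x = chain p r l (d l) x.
Proof.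
move=> dpos; rewrite /balanced; case: eqP => [->|/eqP npr].
  by rewrite -addnn ltnNge leq_addr /= addnK.
by rewrite dpos subn0; case: p r npr => -[].
Qed.

End Relation.

Lemma balanced_mid m (d : 'I_m -> nat) p l n : (0 < n < d l)%N ->
  exists r b, [/\ (b < d l)%N, odd b = odd (d l) &
    forall (k : comNzRingType) (N : lmodType k) (o : bool -> 'I_m -> N -> N) x,
    balanced d o p l n x = chain o p r l b x].
Proof.
move=> /andP[n0 nd]; rewrite /balanced; case n2: (n.*2 < d l)%N.
  by exists (~~ p), (d l - n.*2)%N; split; [lia|lia|by []].
by exists p, (n.*2 - d l)%N; split; [lia|lia|by []].
Qed.

Section Universal.
Variables (k : comNzRingType) (m : nat) (d : 'I_m -> nat) (W : alcoves d).
Variable P : 'I_m -> {poly k}.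
Hypothesis Ptop : forall l, (P l)`_(d l) = 1.
Hypothesis Pbot : forall l, unital (P l)`_0.

Implicit Types (w v u : W) (i j l : 'I_m) (p r : bool).
Local Notation M := (malg W k).
Implicit Types (x y : M).
Local Notation e := (@basis_vector k W).
Local Notation alt := (alternate (@refl _ _ W)).
Local Notation opc f := (fun (_ : bool) i => lext (f i)).

(** The edges of the tree of chosen reduced words. Along them the operators
    permute the basis vectors. *)
Definition preferred_edge i w :=
  (pref w == Some i) || (pref (refl i w) == Some i).
Definition edge_len i w := maxn (len w) (len (refl i w)).

(** The index l such that i and the chosen descent of v are l and l + 1 in some
    order. *)
Definition corner (i : 'I_m) v : option 'I_m :=
  omap (fun j => if j == ordS i then i else j) (pref v).

(** The value at w of the i-th operator when v = s_i w is longer than w and i is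
    not the chosen descent of v. The relation on the bottom u of the dihedral
    coset of v determines it: x is the alternating word on u that leads to w,
    equal to c w plus shorter terms, and s_i x is the term of index t of the
    relation, whose other terms are known. *)
Definition climb (f : 'I_m -> W -> M) i w : M :=
  let v := refl i w in
  if corner i v is Some l then
    let u := bottom l v in
    let p := odd (len u) in
    let r := (i == l) (+) odd (d l).-1 in
    let t := if p == r then d l else 0%N in
    let x := chain (opc f) p r l (d l).-1 (e u) in
    let y := - \sum_(n < (d l).+1 | n != t :> nat)
                 (P l)`_n *: balanced d (opc f) p l n (e u) in
    let c := mcoeff w x in
    partial_inv c *: (partial_inv (P l)`_t *: y - lext (f i) (x - c *: e w))
  else 0.

(** Downwards, the value is forced by the requirement that the operator be an
    involution. *)
Definition step (f : 'I_m -> W -> M) i w : M :=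
  if preferred_edge i w then e (refl i w) else
  if desc i w then
    let y := climb f i (refl i w) in let c := mcoeff w y in
    partial_inv c *: (e (refl i w) - lext (f i) (y - c *: e w))
  else climb f i w.

(** A recursion on the length of the upper end of the edge from w to s_i w. *)
Fixpoint op_rec (n : nat) i w : M :=
  if n is n'.+1 then
    if (edge_len i w <= n')%N then op_rec n' i w else step (op_rec n') i w
  else e (refl i w).

Definition op i w : M := op_rec (edge_len i w) i w.

Lemma edge_len_refl i w : edge_len i (refl i w) = edge_len i w.
Proof. by rewrite /edge_len reflK maxnC. Qed.

Lemma edge_len_desc i w : desc i w -> edge_len i w = len w.
Proof. by move=> /len_desc; rewrite /edge_len; lia. Qed.

Lemma edge_len_asc i w : ~~ desc i w -> edge_len i w = (len w).+1.
Proof. by move=> /len_asc; rewrite /edge_len; lia. Qed.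

Lemma edge_len_le i w : (edge_len i w <= (len w).+1)%N.
Proof. by have [/edge_len_desc|/edge_len_asc] := boolP (desc i w); lia. Qed.

Lemma edge_len_gt0 i w : (0 < edge_len i w)%N.
Proof.
by have [/[dup]/len_desc lw /edge_len_desc ->|/edge_len_asc ->] := boolP (desc i w); rewrite ?lw.
Qed.

Lemma preferred_edge_refl i w : preferred_edge i (refl i w) = preferred_edge i w.
Proof. by rewrite /preferred_edge reflK orbC. Qed.

Lemma op_rec_preferred n i w : preferred_edge i w -> op_rec n i w = e (refl i w).
Proof. by move=> pw; elim: n => //= n ->; rewrite /step pw; case: ifP. Qed.

Lemma op_recE n i w : (edge_len i w <= n)%N -> op_rec n i w = op i w.
Proof.
rewrite /op; elim: n => [|n IHn]; first by have := edge_len_gt0 i w; lia.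
rewrite leq_eqVlt => /predU1P[->//|ltn] /=; rewrite ifT //.
exact: IHn.
Qed.

Lemma op_preferred i w : preferred_edge i w -> op i w = e (refl i w).
Proof. exact: op_rec_preferred. Qed.

Lemma op_step n i w : edge_len i w = n.+1 -> op i w = step (op_rec n) i w.
Proof. by move=> E; rewrite /op E /= E ltnn. Qed.

Local Opaque op op_rec len bottom.

(** Reflections change the parity of the length, so correction terms are shorter
    by at least two. *)
Definition below n w := (len w < n)%N && (odd (len w) == odd n).
Definition low n y := forall w, ~~ below n w -> mcoeff w y = 0.

Lemma below_lt n w : below n w -> (len w + 2 <= n)%N.
Proof. by rewrite /below; lia. Qed.

Lemma low0 n : low n 0.
Proof. by move=> w _; rewrite mcoeff0. Qed.
Lemma lowD n x y : low n x -> low n y -> low n (x + y).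
Proof. by move=> lx ly w nw; rewrite mcoeffD lx ?ly ?addr0. Qed.
Lemma lowZ n a x : low n x -> low n (a *: x).
Proof. by move=> lx w nw; rewrite mcoeffZ lx ?mulr0. Qed.
Lemma lowN n x : low n x -> low n (- x).
Proof. by rewrite -scaleN1r; exact: lowZ. Qed.
Lemma lowB n x y : low n x -> low n y -> low n (x - y).
Proof. by move=> lx /lowN; exact: lowD. Qed.
Lemma low_sum n (I : finType) (Q : pred I) (F : I -> M) :
  (forall a, Q a -> low n (F a)) -> low n (\sum_(a | Q a) F a).
Proof. by move=> lF; elim/big_ind: _ => //; [exact: low0|exact: lowD]. Qed.
Lemma low_basis n w : below n w -> low n (e w).
Proof. by move=> bw w' nw'; rewrite mcoeff_basis; case: eqP nw' => // <-; rewrite bw. Qed.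
Lemma low_le n n' y : (n <= n')%N -> odd n = odd n' -> low n y -> low n' y.
Proof. by move=> le eo ly w nw; apply: ly; move: nw; rewrite /below; lia. Qed.
Lemma low_supp n y w : low n y -> mcoeff w y != 0 -> below n w.
Proof. by move=> ly; apply: contraR => /ly ->. Qed.

Definition leads w y := exists2 c, unital c & low (len w) (y - c *: e w).

Lemma leads_coeff w y : leads w y ->
  unital (mcoeff w y) /\ low (len w) (y - mcoeff w y *: e w).
Proof.
case=> c uc lc; have <- : c = mcoeff w y; last by [].
have nb : ~~ below (len w) w by rewrite /below ltnn.
have /eqP := lc _ nb; rewrite mcoeffB mcoeffZ mcoeff_basis eqxx mulr1 subr_eq0.
by move/eqP.
Qed.

Lemma leads_basis w : leads w (e w).
Proof. by exists 1; [exact: unital1|rewrite scale1r subrr; exact: low0]. Qed.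
Lemma leadsZ w a y : unital a -> leads w y -> leads w (a *: y).
Proof.
move=> ua [c uc lc]; exists (a * c); first exact: unitalM.
by rewrite -scalerA -scalerBr; exact: lowZ.
Qed.
Lemma leadsD w y x : leads w y -> low (len w) x -> leads w (y + x).
Proof. by move=> [c uc lc] lx; exists c => //; rewrite addrAC; exact: lowD. Qed.
Lemma leads_low n w y : below n w -> leads w y -> low n y.
Proof.
move=> bw [c _ lc]; rewrite -(subrK (c *: e w) y); apply: lowD.
  by apply: low_le lc; move: bw; rewrite /below; lia.
by apply/lowZ/low_basis.
Qed.

(** The induction hypothesis of the construction: up to length n, the operators
    are triangular with invertible leading coefficients, and they are
    involutions. *)
Definition controlled n := forall i w, (edge_len i w <= n)%N ->
  [/\ ~~ desc i w -> leads (refl i w) (op i w),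
      desc i w -> low (len w).+1 (op i w) &
      lext (op i) (op i w) = e w].

Section Controlled.
Variables (n : nat) (regn : controlled n).

Lemma op_rec_lext i b y : low b y -> (b <= n.+1)%N ->
  lext (op_rec n i) y = lext (op i) y.
Proof.
move=> ly le; apply: eq_lext => w /(low_supp ly)/below_lt lw.
by apply: op_recE; apply: leq_trans (edge_len_le i w) _; lia.
Qed.

Lemma low_op i b y : low b y -> (b <= n.+1)%N -> low b.+1 (lext (op i) y).
Proof.
move=> ly le; apply: lext_ind => [||a|w /(low_supp ly) bw].
- exact: low0.
- by move=> *; exact: lowD.
- by move=> *; exact: lowZ.
have lw := below_lt bw.
have [|up down _] := regn (i := i) (w := w).
  by apply: leq_trans (edge_len_le i w) _; lia.
have [dw|nw] := boolP (desc i w).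
  by apply: low_le (down dw); move: bw; rewrite /below; lia.
apply: leads_low (up nw); rewrite /below len_asc //.
by move: bw; rewrite /below /=; lia.
Qed.

Lemma opK_low i b y : low b y -> (b <= n.+1)%N ->
  lext (op i) (lext (op i) y) = y.
Proof.
move=> ly le; rewrite lext_comp [RHS]malg_basisE; apply: eq_lext => w.
move=> /(low_supp ly)/below_lt lw.
have [|//] := regn (i := i) (w := w).
by apply: leq_trans (edge_len_le i w) _; lia.
Qed.

Lemma leads_op i w y : leads w y -> ~~ desc i w -> (len w < n)%N ->
  leads (refl i w) (lext (op i) y).
Proof.
move=> [c uc lc] nw lw.
rewrite (lext_split (op i) y c w).
apply: leadsD.
  by apply: leadsZ => //; have [|/(_ nw)] := regn (i := i) (w := w); rewrite ?edge_len_asc.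
by rewrite len_asc //; apply: low_op => //; lia.
Qed.

Lemma leads_chain l u p r b : ~~ desc l u -> ~~ desc (ordS l) u ->
  (b <= d l)%N -> (len u + b <= n)%N ->
  leads (alt r l b u) (chain (opc op) p r l b (e u)) /\
  chain (opc (op_rec n)) p r l b (e u) = chain (opc op) p r l b (e u).
Proof.
move=> nl nl'; elim: b => [|b IHb] leb ltn; first by split=> //; exact: leads_basis.
have [||IH1 IH2] := IHb; [lia..|].
have lenb := len_alternate_up r nl nl' (ltnW leb).
split; first by apply: leads_op => //; [exact: alternate_up|rewrite lenb; lia].
rewrite /= IH2 (@op_rec_lext _ (len u + b).+2); [by []| |lia].
by apply: leads_low IH1; rewrite /below lenb; lia.
Qed.

Lemma letter_neq r l : (letter r l == letter (~~ r) l) = false.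
Proof. by case: r; rewrite /letter /= ?(ordS_neq W) // eq_sym (ordS_neq W). Qed.

Lemma corner_letter r l v :
  pref v = Some (letter (~~ r) l) -> corner (letter r l) v = Some l.
Proof.
move=> Ep; rewrite /corner Ep /=; case: r {Ep} => /=; first by rewrite eqxx.
by rewrite eq_sym (ordSS_neq W).
Qed.

(** The heart of the construction. The relation on the bottom u is linear in the
    single unknown value [op i w], with invertible coefficient, and every other
    value that occurs in it is known: the other longest word ends with the
    preferred edge to v, and all the remaining words stay below v. As v is the
    top of this coset only, no other relation involves that value. *)
Lemma climbP l r0 v i w u p :
    i = letter r0 l -> w = refl i v -> u = bottom l v -> p = odd (len u) ->
    len v = n.+1 -> desc l v -> desc (ordS l) v ->
    pref v = Some (letter (~~ r0) l) ->
  leads v (op i w) /\ dihedral_relation d P (opc op) p l (e u) = 0.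
Proof.
move=> iE w_v u_v pE lv dl dl' Epref; have dpos := order_gt0 W l.
have [nl nl' up lvu] := bottomP dl dl'; rewrite -u_v in nl nl' up lvu.
have di : desc i v by rewrite iE; case: (r0).
have nw : ~~ desc i w by rewrite w_v desc_refl di.
have lw : len w = n by have := len_desc di; rewrite lv -w_v => -[].
have vE : refl i w = v by rewrite w_v reflK.
have npref : preferred_edge i w = false.
  have neq : (Some (letter (~~ r0) l) == Some i) = false.
    by rewrite -[LHS]/(letter (~~ r0) l == i) eq_sym iE letter_neq.
  rewrite /preferred_edge vE Epref neq orbF.
  by apply/eqP => /prefP; rewrite (negbTE nw).
have tw : edge_len i w = n.+1 by rewrite edge_len_asc // lw.
(* the word on u that starts with the bit r ends with i at v *)
have [r rE] : {r | r = r0 (+) odd (d l).-1} by eexists.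
have ir : i = letter (r (+) odd (d l).-1) l by rewrite iE rE addbK.
have r0E : (i == l) = r0.
  by rewrite iE; case: (r0) => /=; rewrite ?eqxx // (ordS_neq W).
have wE : alt r l (d l).-1 u = w.
  by rewrite w_v -(up r) -{2}(prednK dpos) /= -ir reflK.
have ltd : ((d l).-1 < d l)%N by rewrite prednK.
have le2 : (len u + (d l).-1 <= n)%N by move: lv lvu dpos; clear; lia.
have [leadx xE] := leads_chain p r nl nl' (ltnW ltd) le2.
rewrite wE in leadx; have [uc lowx] := leads_coeff leadx.
set x := chain _ _ _ _ _ _ in leadx xE uc lowx.
have [t tE] : {t | t = if p == r then d l else 0%N} by eexists.
have [t' tE'] : {t' | t' = if p == ~~ r then d l else 0%N} by eexists.
have tt' : t' != t by rewrite tE tE'; clear -dpos; case: p r => -[] /=; lia.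
(* away from the unknown term t, the recursion and the limit agree; the other
   longest word, of index t', leads to v and the remaining words stay below *)
have bal b : (b < (d l).+1)%N -> b != t ->
    balanced d (opc (op_rec n)) p l b (e u) = balanced d (opc op) p l b (e u) /\
    (if b == t' then leads v (balanced d (opc op) p l b (e u))
     else low (len v) (balanced d (opc op) p l b (e u))).
  move=> bd bt; case: eqP => [->|/eqP bt'].
    have end_ o := @balanced_end _ _ d _ o p (~~ r) l (e u) dpos.
    rewrite tE' (end_ (opc (op_rec n))) (end_ (opc op)).
    have [lead1 E1] := leads_chain p (~~ r) nl nl' (ltnW ltd) le2.
    have := alternate_up nl nl' (~~ r) ltd.
    have jE : letter (~~ r (+) odd (d l).-1) l = letter (~~ r0) l.
      by rewrite rE addNb addbK.
    have last o := @chain_last _ _ d _ o p (~~ r) l (e u) dpos.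
    rewrite (last (opc (op_rec n))) (last (opc op)) E1 jE.
    have := up (~~ r); rewrite (alternate_last _ _ _ _ dpos) jE.
    set w' := alternate _ _ _ _ _ in lead1 * => vE' nw'.
    set j := letter (~~ r0) l in vE' nw' *.
    have lw' : len w' = n by have := len_asc nw'; rewrite vE' lv => -[].
    have pj : preferred_edge j w' by rewrite /preferred_edge vE' Epref eqxx orbT.
    have [c cu clow] := lead1; set x' := chain (opc op) _ _ _ _ _ in clow *.
    have split (f : 'I_m -> W -> M) := lext_split (f j) x' c w'.
    rewrite lw' in clow.
    split.
      rewrite (split (op_rec n)) (split op) (op_rec_lext j clow (leqnSn n)).
      by rewrite (op_rec_preferred n pj) (op_preferred pj).
    rewrite split; apply: leadsD; last by rewrite lv; apply: low_op clow _.
    by apply: leadsZ => //; rewrite (op_preferred pj) vE'; exact: leads_basis.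
  have [|s [b' [ltb' ob' balE]]] := @balanced_mid _ d p l b.
    by move: bd bt bt'; rewrite tE tE'; clear -dpos; case: p r => -[] /=; lia.
  have leb' : (len u + b' <= n)%N by move: lv lvu ltb'; clear; lia.
  have [leadb Eb] := leads_chain p s nl nl' (ltnW ltb') leb'.
  rewrite (balE _ _ (opc (op_rec n))) (balE _ _ (opc op)) Eb; split=> //.
  apply: leads_low leadb; rewrite /below (len_alternate_up s nl nl' (ltnW ltb')).
  by move: lvu ltb' ob'; clear; lia.
pose T : M := - \sum_(b < (d l).+1 | b != t :> nat)
                 (P l)`_b *: balanced d (opc op) p l b (e u).
have ltt : (t < (d l).+1)%N by rewrite tE; case: ifP.
have ltt' : (t' < (d l).+1)%N by rewrite tE'; case: ifP.
have Punit b : b = d l \/ b = 0%N -> unital (P l)`_b.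
  by case=> ->; [rewrite Ptop; exact: unital1|exact: Pbot].
have uPt : unital (P l)`_t by apply: Punit; rewrite tE; case: ifP; auto.
have uPt' : unital (P l)`_t' by apply: Punit; rewrite tE'; case: ifP; auto.
have leadT : leads v (partial_inv (P l)`_t *: T).
  apply: leadsZ; first exact: unital_inv.
  rewrite /T (bigD1 (Ordinal ltt') tt') opprD; apply: leadsD.
    rewrite -scaleNr; apply: leadsZ; first exact: unitalN.
    by have [_] := bal t' ltt' tt'; rewrite eqxx.
  apply/lowN/low_sum => b /andP[bt bt']; apply: lowZ.
  by have [_] := bal b (ltn_ord b) bt; rewrite -val_eqE in bt'; rewrite ifN.
set c := mcoeff w x in uc lowx.
have opE : op i w =
    partial_inv c *: (partial_inv (P l)`_t *: T - lext (op i) (x - c *: e w)).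
  rewrite (op_step tw) /step npref (negbTE nw) /climb vE {1}iE.
  rewrite (corner_letter Epref) -u_v -pE r0E -rE -tE xE -/c.
  have lowx' : low n (x - c *: e w) by rewrite -lw.
  rewrite (op_rec_lext i lowx' (leqnSn n)) /T.
  rewrite (eq_bigr (fun b : 'I_(d l).+1 =>
    (P l)`_b *: balanced d (opc op) p l b (e u))); first by [].
  by move=> b bt; have [-> _] := bal b (ltn_ord b) bt.
split.
  rewrite opE; apply/leadsZ/leadsD => //; first exact: unital_inv.
  apply: lowN; rewrite lv -lw; apply: low_op lowx _.
  by rewrite lw.
have topE : balanced d (opc op) p l t (e u) = partial_inv (P l)`_t *: T.
  rewrite {1}tE (@balanced_end _ _ d _ (opc op) p r l (e u) dpos).
  rewrite (@chain_last _ _ d _ (opc op) p r l (e u) dpos) -ir -/x.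
  rewrite (lext_split (op i) x c w).
  by rewrite opE scalerA (partial_invP uc) scale1r subrK.
rewrite /dihedral_relation (bigD1 (Ordinal ltt)) /=; last by [].
rewrite topE.
rewrite scalerA (partial_invP uPt) scale1r /T addrC.
exact: subrr.
Qed.

Lemma corner_desc i v l : desc i v -> pref v != Some i -> corner i v = Some l ->
  exists r, [/\ i = letter r l, pref v = Some (letter (~~ r) l),
     desc l v & desc (ordS l) v].
Proof.
move=> di; rewrite /corner; case Ep: (pref v) => [j|//] ij /= [lE].
have dj := prefP Ep; have {}ij : i != j by apply: contra ij => /eqP ->.
have [l' [r [iE jE]]] := two_letters ij di dj; exists r.
have {lE}-> : l = l'.
  rewrite -lE iE jE; case: (r) => /=; first by rewrite eqxx.
  by rewrite eq_sym (ordSS_neq W).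
have [dl dl'] : desc l' v /\ desc (ordS l') v.
  by move: di dj; rewrite iE jE; case: (r).
by rewrite -jE.
Qed.

End Controlled.

Lemma controlled0 : controlled 0.
Proof. by move=> i w; rewrite leqNgt edge_len_gt0. Qed.

(** Edges with upper end of length n + 1 are either preferred, or climb to the
    top of a dihedral coset, or descend from it. *)
Lemma controlledS n : controlled n -> controlled n.+1.
Proof.
move=> regn i w; rewrite leq_eqVlt ltnS => /predU1P[tw|]; last exact: regn.
have [pe|npe] := boolP (preferred_edge i w).
  rewrite (op_preferred pe) lext_basis op_preferred ?preferred_edge_refl // reflK.
  split=> // [_|dw]; first exact: leads_basis.
  apply: low_basis; rewrite /below (len_desc dw); lia.
have climb_leads v : desc i v -> len v = n.+1 -> ~~ preferred_edge i v ->
    leads v (op i (refl i v)).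
  move=> dv lv; rewrite negb_or => /andP[npv _].
  have [j Ej] : exists j, pref v = Some j.
    case Ej: (pref v) => [j|]; first by exists j.
    by move: lv; rewrite (prefN Ej) len_base.
  have [l El] : exists l, corner i v = Some l by rewrite /corner Ej; eexists.
  have [r [iE Epref dl dl']] := corner_desc dv npv El.
  by have [] := climbP regn iE erefl erefl erefl lv dl dl' Epref.
have descE v : desc i v -> len v = n.+1 -> ~~ preferred_edge i v ->
    let y := op i (refl i v) in let c := mcoeff v y in
    op i v = partial_inv c *: (e (refl i v) - lext (op i) (y - c *: e v)).
  move=> dv lv npv y c; have tv : edge_len i v = n.+1 by rewrite edge_len_desc.
  have [_ lowy] := leads_coeff (climb_leads v dv lv npv).
  rewrite (op_step tv) /step (negbTE npv) dv.
  have climbE : climb (op_rec n) i (refl i v) = y.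
    rewrite /y (op_step (n := n)) ?edge_len_refl // /step preferred_edge_refl.
    by rewrite (negbTE npv) desc_refl dv.
  rewrite climbE -/c (op_rec_lext i (b := len v)) ?lv //.
  by rewrite -lv.
have inv v : desc i v -> len v = n.+1 -> ~~ preferred_edge i v ->
    lext (op i) (op i (refl i v)) = e (refl i v) /\
    (low (len v).+1 (op i v) /\ lext (op i) (op i v) = e v).
  move=> dv lv npv; have leadv := climb_leads v dv lv npv.
  have [uc lowy] := leads_coeff leadv; have Ev := descE v dv lv npv.
  set y := op i (refl i v) in uc lowy Ev *; set c := mcoeff v y in uc lowy Ev *.
  have lowy' : low n.+1 (y - c *: e v) by rewrite -lv.
  split; [|split].
  - rewrite (lext_split (op i) y c v) Ev scalerA (partial_invP uc) scale1r.
    exact: subrK.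
  - rewrite Ev; apply/lowZ/lowB; last first.
      by rewrite lv; exact: (low_op regn i lowy' (leqnn _)).
    by apply: low_basis; rewrite /below (len_desc dv); lia.
  - rewrite Ev linearZ linearB /= lext_basis (opK_low regn i lowy' (leqnn _)) -/y.
    by rewrite opprB addrCA subrr addr0 scalerA mulrC (partial_invP uc) scale1r.
have [dw|nw] := boolP (desc i w).
  have lw : len w = n.+1 by rewrite -tw edge_len_desc.
  by have [_ []] := inv w dw lw npe.
have dv : desc i (refl i w) by rewrite desc_refl.
have lv : len (refl i w) = n.+1 by rewrite -tw edge_len_asc // len_asc.
have npe' : ~~ preferred_edge i (refl i w) by rewrite preferred_edge_refl.
have [invw _] := inv _ dv lv npe'; have leadv := climb_leads _ dv lv npe'.
by rewrite reflK in invw leadv.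
Qed.

Lemma op_controlled n : controlled n.
Proof. by elim: n => [|n]; [exact: controlled0|exact: controlledS]. Qed.

End Universal.

Local Opaque op op_rec len bottom.

(** * Dihedral relations and powers of the rotation *)

Section RelationTheory.
Variables (k : comNzRingType) (m : nat) (d : 'I_m -> nat).
Variables (P : 'I_m -> {poly k}) (N : lmodType k) (o : bool -> 'I_m -> N -> N).
Hypothesis o_linear : forall p i, linear (o p i).
Hypothesis oK : forall p i x, o (~~ p) i (o p i x) = x.

Lemma flipD p i x y : o p i (x + y) = o p i x + o p i y.
Proof. by have := o_linear p i 1 x y; rewrite !scale1r. Qed.
Lemma flip0 p i : o p i 0 = 0.
Proof. by apply: (addrI (o p i 0)); rewrite -flipD !addr0. Qed.
Lemma flipZ p i a x : o p i (a *: x) = a *: o p i x.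
Proof. by have := o_linear p i a x 0; rewrite !addr0 flip0 addr0. Qed.

Lemma flipVK p i x : o p i (o (~~ p) i x) = x.
Proof. by rewrite -{1}(negbK p) oK. Qed.

Lemma chain_linear p r l n : linear (chain o p r l n).
Proof. by elim: n => //= n IHn a x y; rewrite IHn flipD flipZ. Qed.

Lemma relation_linear p l : linear (dihedral_relation d P o p l).
Proof.
move=> a x y; rewrite /dihedral_relation scaler_sumr -big_split; apply: eq_bigr => n _.
by rewrite /balanced; case: ifP => _; rewrite chain_linear scalerDr !scalerA mulrC.
Qed.

Lemma chainSr p r l n x :
  chain o p r l n.+1 x = chain o (~~ p) (~~ r) l n (o p (letter r l) x).
Proof.
elim: n => [|n IHn]; first by rewrite /= !addbF.
by rewrite -[LHS]/(o _ _ (chain o p r l n.+1 x)) IHn /= !addbN !addNb.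
Qed.

Lemma chain_cancel p r l n x :
  chain o (~~ p) r l n.+1 (o p (letter r l) x) = chain o p (~~ r) l n x.
Proof. by rewrite chainSr oK negbK. Qed.

Lemma balanced_shift p r l n x :
  balanced d o (~~ p) l n (o p (letter r l) x) =
  o (p (+) odd (d l)) (letter (r (+) odd (d l)) l) (balanced d o p l n x).
Proof.
have oddk b : odd (d l) = odd b -> forall y, o (p (+) odd (d l))
    (letter (r (+) odd (d l)) l) y = o (p (+) odd b) (letter (r (+) odd b) l) y.
  by move=> ->.
have cancel b y : odd (d l) = odd b.+1 -> o (p (+) odd (d l))
    (letter (r (+) odd (d l)) l) (chain o p (~~ r) l b.+1 y) =
    chain o p (~~ r) l b y.
  by move=> -> /=; rewrite !addbN addNb oK.
rewrite /balanced; case: ltnP => le.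
  have [b bE] : exists b, (d l - n.*2 = b.+1)%N.
    by exists (d l - n.*2).-1; rewrite prednK // subn_gt0.
  have odE : odd (d l) = odd b.+1 by rewrite -bE oddB ?odd_double ?addbF // ltnW.
  rewrite bE negbK; have [rp|/eqP rp] := eqVneq r p.
    by subst r; rewrite chain_cancel cancel.
  have pE : p = ~~ r by case: p r rp {cancel oddk} => -[].
  by subst p; rewrite -(chainSr (~~ r) r) negbK odE.
have odE : odd (d l) = odd (n.*2 - d l) by rewrite oddB // odd_double.
move: (n.*2 - d l)%N odE => b odE; have [rp|/eqP rp] := eqVneq r p.
  by subst r; rewrite -chainSr odE.
have pE : p = ~~ r by case: p r rp {cancel oddk} => -[].
subst p; case: b odE => [|b] odE; first by rewrite odE !addbF.
rewrite cancel //; have := chain_cancel (~~ r) r l b x.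
by rewrite !negbK => ->.
Qed.

(** A reflection applied to x moves all the alternating words on x by one letter
    in the same direction, so it carries the relation on x to the relation on
    the image of x. *)
Lemma relation_shift p r l x :
  dihedral_relation d P o (~~ p) l (o p (letter r l) x) =
  o (p (+) odd (d l)) (letter (r (+) odd (d l)) l) (dihedral_relation d P o p l x).
Proof.
rewrite /dihedral_relation (big_morph _ (flipD _ _) (flip0 _ _)).
by apply: eq_bigr => n _; rewrite flipZ balanced_shift.
Qed.

Lemma relation0 p l : dihedral_relation d P o p l 0 = 0.
Proof.
by have := relation_linear p l (-1) 0 0; rewrite scaler0 addr0 scaleN1r addNr.
Qed.
Lemma relationD p l x y : dihedral_relation d P o p l x = 0 -> dihedral_relation d P o p l y = 0 ->
  dihedral_relation d P o p l (x + y) = 0.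
Proof.
by move=> rx ry; rewrite -[x]scale1r relation_linear rx ry scaler0 addr0.
Qed.
Lemma relationZ p l a x : dihedral_relation d P o p l x = 0 ->
  dihedral_relation d P o p l (a *: x) = 0.
Proof.
by move=> rx; rewrite -[_ *: x]addr0 relation_linear rx relation0 scaler0 addr0.
Qed.

Definition rotate p l x := o (~~ p) (letter (~~ p) l) (o p (letter p l) x).

Lemma balancedS p l n x : (n < d l)%N ->
  balanced d o p l n.+1 x = rotate (p (+) odd (d l)) l (balanced d o p l n x).
Proof.
move=> ltn; rewrite /rotate /balanced.
(* two more letters forward add a rotation, two more letters backward cancel one *)
have shape b : chain o p p l b.+2 x =
    rotate (p (+) odd b) l (chain o p p l b x).
  by rewrite /rotate /= !addbN.
have unshape b : rotate (p (+) odd b) l (chain o p (~~ p) l b.+2 x) =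
    chain o p (~~ p) l b x.
  by rewrite /rotate /= !addbN !addNb !negbK flipVK oK.
rewrite -/(rotate _ _ _); case: (ltnP n.+1.*2 (d l)) => le1.
  have le2 : (n.*2 < d l)%N by lia.
  have bE : (d l - n.*2 = (d l - n.+1.*2).+2)%N by lia.
  have odE : odd (d l) = odd (d l - n.+1.*2) by lia.
  by rewrite le2 bE odE unshape.
have [le2|le2] := ltnP n.*2 (d l); last first.
  have bE : (n.+1.*2 - d l = (n.*2 - d l).+2)%N by lia.
  have odE : odd (d l) = odd (n.*2 - d l) by lia.
  by rewrite bE odE shape.
have [dE|dE] : d l = n.+1.*2 \/ d l = n.*2.+1 by lia.
  have -> : (n.+1.*2 - d l = 0)%N by lia.
  have -> : (d l - n.*2 = 2)%N by lia.
  have -> : odd (d l) = odd 0 by lia.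
  by rewrite unshape.
have -> : (n.+1.*2 - d l = 1)%N by lia.
have -> : (d l - n.*2 = 1)%N by lia.
have -> : odd (d l) = true by lia.
by rewrite /rotate /= !addbF addbT !negbK oK.
Qed.

(** In this form the relation says that P_l annihilates the rotation, which is
    what holds in the algebra. *)
Lemma relation_iter p l x : dihedral_relation d P o p l x =
  \sum_(n < (d l).+1)
    (P l)`_n *: iter n (rotate (p (+) odd (d l)) l) (balanced d o p l 0 x).
Proof.
apply: eq_bigr => n _; congr (_ *: _).
elim: (n : nat) (leq_ord n) => // b IHb leb.
by rewrite iterS -IHb ?balancedS // ltnW.
Qed.

End RelationTheory.

(** * The dihedral relations on the whole free module *)

Section Limit.
Variables (k : comNzRingType) (m : nat) (d : 'I_m -> nat) (W : alcoves d).
Variable P : 'I_m -> {poly k}.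
Hypothesis Ptop : forall l, (P l)`_(d l) = 1.
Hypothesis Pbot : forall l, unital (P l)`_0.

Implicit Types (w v u : W) (i j l : 'I_m) (p r : bool).
Local Notation M := (malg W k).
Implicit Types (x y : M).
Local Notation e := (@basis_vector k W).
Local Notation alt := (alternate (@refl _ _ W)).
Local Notation op := (@op k m d W P).
Local Notation opp := (fun (_ : bool) i => lext (op i)).
Let reg := @op_controlled k m d W P Ptop Pbot.

Lemma op_low i b y : low b y -> low b.+1 (lext (op i) y).
Proof. by move=> ly; apply: low_op (leqnSn b); first exact: reg. Qed.

Lemma opK i y : lext (op i) (lext (op i) y) = y.
Proof.
rewrite lext_comp [RHS]malg_basisE; apply: eq_lext => w _.
by have [] := @reg _ _ _ (leqnn (edge_len i w)).
Qed.

Lemma op_leads i w : ~~ desc i w -> leads (refl i w) (op i w).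
Proof. by have [] := @reg _ _ _ (leqnn (edge_len i w)). Qed.

Lemma chain_leads l u p r b : ~~ desc l u -> ~~ desc (ordS l) u ->
  (b <= d l)%N -> leads (alt r l b u) (chain opp p r l b (e u)).
Proof.
by move=> nl nl' le; have [] := leads_chain (@reg (len u + b)) p r nl nl' le (leqnn _).
Qed.

Lemma summit l u : ~~ desc l u -> ~~ desc (ordS l) u ->
  exists v, [/\ desc l v, desc (ordS l) v, bottom l v = u & len v = (len u + d l)%N].
Proof.
move=> nl nl'; have dpos := order_gt0 W l; exists (alt true l (d l) u).
have ltd : ((d l).-1 < d l)%N by rewrite prednK.
have dv r : desc (letter (r (+) odd (d l).-1) l) (alt true l (d l) u).
  have -> : alt true l (d l) u = alt r l (d l) u.
    by case: r => //; exact: braid.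
  by rewrite alternate_last // desc_refl (alternate_up nl nl').
have dvl s : desc (letter s l) (alt true l (d l) u).
  by have := dv (s (+) odd (d l).-1); rewrite addbK.
split; [exact: (dvl true)|exact: (dvl false)| |exact: len_alternate_up].
have -> : alt true l (d l) u = alt (odd (d l)) l (d l) u.
  by case: (odd _) => //; exact: braid.
have := alternateK (@reflK _ _ W) (odd (d l)) l (d l) u.
by rewrite addbN addbb.
Qed.

Lemma relation_bottom l u : ~~ desc l u -> ~~ desc (ordS l) u ->
  dihedral_relation d P opp (odd (len u)) l (e u) = 0.
Proof.
move=> nl nl'; have [v [dl dl' bv lv]] := summit nl nl'.
have [j Ej] : exists j, pref v = Some j.
  case Ej: (pref v) => [j|]; first by exists j.
  by move: dl; rewrite (prefN Ej) desc_base_false.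
have [r jE] : exists r, j = letter (~~ r) l.
  case/orP: (desc_two dl dl' (prefP Ej)) => /eqP ->.
    by exists false.
  by exists true.
rewrite jE in Ej; have dpos := order_gt0 W l.
have lv' : len v = (len v).-1.+1 by rewrite lv -(prednK dpos) addnS.
have [_ ->] := climbP Ptop Pbot (@reg (len v).-1) erefl erefl (esym bv) erefl lv' dl dl' Ej.
by [].
Qed.

Definition homogeneous p y := forall w, mcoeff w y != 0 -> odd (len w) = p.

Let opp_linear p i : linear (opp p i) := lext_linear _.
Let oppK p i y : opp (~~ p) i (opp p i y) = y := opK i y.

Lemma relation_lext p l y :
  (forall w, mcoeff w y != 0 -> dihedral_relation d P opp p l (e w) = 0) ->
  dihedral_relation d P opp p l y = 0.
Proof.
move=> rel; rewrite [y]malg_basisE.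
apply: (lext_ind (S := fun z => dihedral_relation d P opp p l z = 0)).
- exact: (relation0 d P opp_linear).
- by move=> *; apply: (relationD opp_linear).
- by move=> *; apply: (relationZ opp_linear).
- exact: rel.
Qed.

(** The relations were imposed at the bottoms of dihedral cosets. A vector w
    that is not one is, up to shorter vectors and an invertible factor, the
    image of a shorter vector by one of the two reflections, and reflections
    carry relations to relations. *)
Lemma relation_basis l w : dihedral_relation d P opp (odd (len w)) l (e w) = 0.
Proof.
elim: (len w).+1 {-2}w (ltnSn (len w)) => // {}n IHn {}w lt.
have [[r dr]|nd] : (exists r, desc (letter r l) w) \/ (forall r, ~~ desc (letter r l) w).
  have [d1|n1] := boolP (desc l w); first by left; exists true.
  have [d2|n2] := boolP (desc (ordS l) w); first by left; exists false.
  by right => -[].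
2: exact: relation_bottom (nd true) (nd false).
set i := letter r l in dr; pose w' := refl i w.
have nw' : ~~ desc i w' by rewrite desc_refl dr.
have [c uc lowc] := op_leads nw'; rewrite reflK in lowc.
have lw : len w = (len w').+1 by exact: len_desc.
have -> : e w = - partial_inv c *: (op i w' - c *: e w) + partial_inv c *: op i w'.
  rewrite scalerBr scalerA mulNr mulrC (partial_invP uc) !scaleNr scale1r opprK.
  by rewrite addrAC addNr add0r.
apply: (relationD opp_linear) => //; last first.
  apply: (relationZ opp_linear) => //; rewrite -(lext_basis (op i) w') lw /=.
  rewrite (relation_shift d P opp_linear oppK (odd (len w')) r l (e w')) IHn ?linear0 //.
  by move: lt; rewrite lw.
apply: (relationZ opp_linear) => //; apply: relation_lext => v vy.
have /andP[lv /eqP <-] := low_supp lowc vy.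
by apply: IHn; apply: leq_trans lv _.
Qed.

Lemma op_relation p l y : homogeneous p y -> dihedral_relation d P opp p l y = 0.
Proof. by move=> hy; apply: relation_lext => w /hy <-; exact: relation_basis. Qed.

End Limit.

(** * Maps out of the free module *)

Lemma unital_scaler0 (k : comNzRingType) (N : lmodType k) (a : k) (x : N) :
  unital a -> a *: x = 0 -> x = 0.
Proof. by case=> b ab ax; rewrite -[x]scale1r -ab mulrC -scalerA ax scaler0. Qed.

Section Intertwiner.
Variables (k : comNzRingType) (m : nat) (d : 'I_m -> nat) (W : alcoves d).
Variable P : 'I_m -> {poly k}.
Hypothesis Ptop : forall l, (P l)`_(d l) = 1.
Hypothesis Pbot : forall l, unital (P l)`_0.
Variables (N : lmodType k) (o : bool -> 'I_m -> N -> N).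
Hypothesis o_linear : forall p i, linear (o p i).
Hypothesis oK : forall p i x, o (~~ p) i (o p i x) = x.
Hypothesis o_relation : forall p l x, dihedral_relation d P o p l x = 0.
Variable x0 : N.

Implicit Types (w v u : W) (i j l : 'I_m) (p r : bool).
Local Notation M := (malg W k).
Implicit Types (x y : M).
Local Notation e := (@basis_vector k W).
Local Notation alt := (alternate (@refl _ _ W)).
Local Notation op := (@op k m d W P).
Local Notation opp := (fun (_ : bool) i => lext (op i)).

HB.instance Definition _ p i :=
  GRing.isLinear.Build k N N *:%R (o p i) (o_linear p i).

Fixpoint word_rec (n : nat) w : N :=
  if n is n'.+1 then
    if pref w is Some i then o (odd n') i (word_rec n' (refl i w)) else x0
  else x0.

(** The chosen reduced word of w, applied to x0. *)
Definition word w := word_rec (len w) w.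

Lemma wordE w i : pref w = Some i ->
  word w = o (odd (len (refl i w))) i (word (refl i w)).
Proof. by move=> Ew; rewrite /word (len_pref Ew) /= Ew. Qed.

Lemma word_base : word (base W) = x0.
Proof. by rewrite /word len_base. Qed.

Local Notation beta := (lext word).

Definition compatible i w := beta (op i w) = o (odd (len w)) i (word w).

Lemma compatible_ext p i y : homogeneous p y ->
    (forall w, mcoeff w y != 0 -> compatible i w) ->
  beta (lext (op i) y) = o p i (beta y).
Proof.
move=> hy cy; rewrite !lext_comp; apply: eq_lext => w wy.
by rewrite /= cy // (hy w wy).
Qed.

Lemma leads_supp w y v : leads w y -> mcoeff v y != 0 ->
  v = w \/ below (len w) v.
Proof.
move=> [c _ lowc] vy; have [->|nvw] := eqVneq v w; first by left.
right; apply: low_supp lowc _; rewrite mcoeffB mcoeffZ mcoeff_basis.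
by rewrite [w == v]eq_sym (negbTE nvw) mulr0 subr0.
Qed.

Lemma leads_homogeneous w y : leads w y -> homogeneous (odd (len w)) y.
Proof. by move=> lw v /(leads_supp lw)[->|/andP[_ /eqP]]. Qed.

Lemma compatible_leads i w y : leads w y -> compatible i w ->
    (forall v, below (len w) v -> compatible i v) ->
  beta (lext (op i) y) = o (odd (len w)) i (beta y).
Proof.
move=> lw cw clow; apply: compatible_ext; first exact: leads_homogeneous.
by move=> v /(leads_supp lw)[->|/clow].
Qed.

Lemma compatible_preferred i w : preferred_edge i w -> compatible i w.
Proof.
move=> pe; rewrite /compatible op_preferred // lext_basis.
case/orP: pe => /eqP Ep; rewrite (wordE Ep).
  by rewrite odd_len (flipVK oK).
by rewrite reflK.
Qed.

(** All the terms of the relation on x but the longest word starting with r are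
    known to be sent to the corresponding terms of the relation on z; as its
    coefficient is invertible, so is that last term. *)
Lemma relation_solve l p r x (z : N) : (0 < d l)%N ->
    dihedral_relation d P opp p l x = 0 -> beta x = z ->
    (forall b s, (b < d l)%N ->
       beta (chain opp p s l b x) = chain o p s l b z) ->
    beta (chain opp p (~~ r) l (d l) x) = chain o p (~~ r) l (d l) z ->
  beta (chain opp p r l (d l) x) = chain o p r l (d l) z.
Proof.
move=> dpos relx xz short long.
have [t tE] : {t | t = if p == r then d l else 0%N} by eexists.
have [t' tE'] : {t' | t' = if p == ~~ r then d l else 0%N} by eexists.
have ltt : (t < (d l).+1)%N by rewrite tE; case: ifP.
have end_ s := @balanced_end _ _ d _ opp p s l x dpos.
have end_o s := @balanced_end _ _ d _ o p s l z dpos.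
have bal b : (b < (d l).+1)%N -> b != t ->
    beta (balanced d opp p l b x) = balanced d o p l b z.
  move=> bd bt; have [->|/eqP bt'] := eqVneq b t'.
    by rewrite tE' end_ end_o.
  have [|s [b' [ltb' _ balE]]] := @balanced_mid _ d p l b.
    by move: bd bt bt'; rewrite tE tE'; clear -dpos; case: p r => -[] /=; lia.
  by rewrite (balE _ _ opp) (balE _ _ o) short.
have /eqP : beta (dihedral_relation d P opp p l x) - dihedral_relation d P o p l z = 0.
  by rewrite relx o_relation linear0 subr0.
rewrite /dihedral_relation linear_sum -sumrB (bigD1 (Ordinal ltt)) //= big1 => [|b bt].
  rewrite addr0 linearZ -scalerBr => /eqP /unital_scaler0 H.
  rewrite -(end_ r) -(end_o r) -tE; apply/eqP; rewrite -subr_eq0; apply/eqP/H.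
  by rewrite tE; case: ifP => _; [rewrite Ptop; exact: unital1|exact: Pbot].
by rewrite linearZ /= -scalerBr bal ?subrr ?scaler0.
Qed.

(** The operators on the free module were forced by the relations and the
    involutivity, which also hold in N; the induction follows the recursion that
    defines them. *)
Lemma compatible_all i w : compatible i w.
Proof.
elim: (edge_len i w).+1 {-2}i {-2}w (ltnSn (edge_len i w)) => // n IHn {}i {}w.
rewrite ltnS leq_eqVlt => /predU1P[tw|/IHn//].
have [pe|npe] := boolP (preferred_edge i w); first exact: compatible_preferred.
have asc v : desc i v -> edge_len i v = n -> ~~ preferred_edge i v ->
    compatible i (refl i v).
  move=> dv tv npv; have lv : len v = n by rewrite -tv edge_len_desc.
  move: npv; rewrite negb_or => /andP[npv _].
  have [j Ej] : exists j, pref v = Some j.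
    case Ej: (pref v) => [j|]; first by exists j.
    by move: dv; rewrite (prefN Ej) desc_base_false.
  have [l El] : exists l, corner i v = Some l by rewrite /corner Ej; eexists.
  have [r0 [iE Epref dl dl']] := corner_desc dv npv El.
  have [nl nl' up lvu] := bottomP dl dl'.
  move: (bottom l v) nl nl' up lvu => u nl nl' up lvu.
  have dpos := order_gt0 W l.
  have ltd : ((d l).-1 < d l)%N by rewrite prednK.
  have small b s : (b < d l)%N -> forall z,
      mcoeff z (chain opp (odd (len u)) s l b (e u)) != 0 ->
      (len z <= len u + b)%N.
    move=> ltb z /(leads_supp (chain_leads Ptop Pbot _ _ nl nl' (ltnW ltb))).
    rewrite -(len_alternate_up s nl nl' (ltnW ltb)).
    by case=> [->|/below_lt]; last by lia.
  have short b s : (b < d l)%N ->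
      beta (chain opp (odd (len u)) s l b (e u)) = chain o (odd (len u)) s l b (word u).
    elim: b => [|b IHb] ltb; first by rewrite /= lext_basis.
    rewrite /= -IHb ?(ltnW ltb) //; apply: compatible_ext.
      have := leads_homogeneous (chain_leads Ptop Pbot (odd (len u)) s nl nl' (ltnW (ltnW ltb))).
      by rewrite len_alternate_up ?oddD // ltnW // ltnW.
    move=> z /(small b s (ltnW ltb)) lz; apply: IHn.
    by apply: leq_trans (_ : (len z).+2 <= n)%N; [rewrite ltnS edge_len_le|lia].
  (* r is the bit of the first letter of the word on u that ends with i *)
  have [r rE] : {r | r = r0 (+) odd (d l).-1} by eexists.
  have letterE s : letter (r (+) s (+) odd (d l).-1) l = letter (r0 (+) s) l.
    by rewrite rE addbAC addbK.
  pose lead s := chain_leads Ptop Pbot (odd (len u)) s nl nl' (ltnW ltd).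
  pose pre s := alt s l (d l).-1 u.
  have lpre s : len (pre s) = (len u + (d l).-1)%N.
    exact: len_alternate_up (ltnW ltd).
  have lowIH s i' z : below (len (pre s)) z -> compatible i' z.
    move=> /below_lt; rewrite lpre => lz; apply: IHn.
    by apply: leq_trans (_ : (len z).+2 <= n)%N; [rewrite ltnS edge_len_le|lia].
  have preE s : refl (letter (r0 (+) s) l) (pre (r (+) s)) = v.
    by rewrite -(up (r (+) s)) alternate_last // letterE.
  have par s : odd (len u) (+) odd (d l).-1 = odd (len (pre s)) by rewrite lpre oddD.
  have long : beta (chain opp (odd (len u)) (~~ r) l (d l) (e u)) =
      chain o (odd (len u)) (~~ r) l (d l) (word u).
    rewrite (@chain_last _ _ d _ opp) // (@chain_last _ _ d _ o) //.
    rewrite -[~~ r]addbT letterE -short // (par (r (+) true)).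
    apply: (compatible_leads (lead (r (+) true))); last exact: lowIH.
    apply: compatible_preferred; rewrite /preferred_edge preE.
    by rewrite -[~~ r0]addbT in Epref; rewrite Epref eqxx orbT.
  have := relation_solve dpos (relation_bottom Ptop Pbot nl nl') (lext_basis _ _) short long.
  rewrite (@chain_last _ _ d _ opp) // (@chain_last _ _ d _ o) //.
  have := letterE false; rewrite !addbF => ->; rewrite -iE -short // (par r).
  have := preE false; rewrite !addbF -iE => preE'.
  have -> : refl i v = pre r by rewrite -preE' reflK.
  have [c uc lowc] := lead r; rewrite -/(pre r) in lowc.
  move: (chain opp _ _ _ _ _) lowc => x lowc.
  rewrite (lext_split (op i) x c (pre r)) linearD linearZ /=.
  rewrite [lext word (lext _ (x - _))](@compatible_ext (odd (len (pre r)))); first last.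
  - by move=> z /(low_supp lowc)/lowIH.
  - by move=> z /(low_supp lowc)/andP[_ /eqP].
  rewrite (lext_split word x c (pre r)) [in RHS]linearD [in RHS]linearZ /=.
  move/addIr/eqP; rewrite -subr_eq0 -scalerBr => /eqP/(unital_scaler0 uc)/eqP.
  by rewrite subr_eq0 => /eqP.
have [dw|nw] := boolP (desc i w); last first.
  have dv : desc i (refl i w) by rewrite desc_refl.
  rewrite -[w](@reflK _ _ W i); apply: asc => //; first by rewrite edge_len_refl.
  by rewrite preferred_edge_refl.
have cw := asc w dw tw npe; set w' := refl i w in cw.
have nw' : ~~ desc i w' by rewrite desc_refl dw.
have [c uc lowc] := op_leads Ptop Pbot nw'; rewrite reflK in lowc.
have low_comp z : mcoeff z (op i w' - c *: e w) != 0 -> compatible i z.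
  move=> /(low_supp lowc)/below_lt lz; apply: IHn; rewrite -tw.
  apply: leq_trans (_ : (len z).+2 <= _)%N; first by rewrite ltnS edge_len_le.
  by rewrite edge_len_desc //; lia.
have low_hom : homogeneous (odd (len w)) (op i w' - c *: e w).
  by move=> z /(low_supp lowc)/andP[_ /eqP].
have := congr1 beta (opK Ptop Pbot i (e w')).
rewrite lext_basis (lext_split (op i) (op i w') c w) linearD linearZ /= lext_basis.
rewrite (compatible_ext low_hom low_comp) => E1.
have E2 : o (odd (len w)) i (beta (op i w')) = word w'.
  by rewrite cw /w' odd_len (flipVK oK).
rewrite -E2 (lext_split word (op i w') c w) [in RHS]linearD [in RHS]linearZ /= in E1.
move/addIr/eqP: E1; rewrite -subr_eq0 -scalerBr => /eqP/(unital_scaler0 uc)/eqP.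
by rewrite subr_eq0 => /eqP.
Qed.

Lemma intertwine_op p i y : homogeneous p y ->
  beta (lext (op i) y) = o p i (beta y).
Proof. by move=> hy; apply: compatible_ext => // w _; exact: compatible_all. Qed.

End Intertwiner.

(** * Independence over a commutative ring and polynomials in an operator *)

(** If m < n, pad A with zero columns to an injective square matrix B. The last
    column of any multiple of B vanishes, so a polynomial that annihilates B has
    constant term 0; by injectivity its quotient by the variable annihilates B
    too. Hence only 0 annihilates B, which contradicts the Cayley-Hamilton
    theorem. *)
Lemma row_injective_leq (k : comNzRingType) n m (A : 'M[k]_(n, m)) :
  (forall v : 'rV_n, v *m A = 0 -> v = 0) -> (n <= m)%N.
Proof.
case: n A => [//|n] A injA; rewrite leqNgt; apply/negP => ltmn.
pose B : 'M[k]_n.+1 := \matrix_(i, j) oapp (A i) 0 (insub (j : nat)).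
have injB (v : 'rV_n.+1) : v *m B = 0 -> v = 0.
  move=> vB; apply: injA; apply/rowP => j; rewrite !mxE.
  have := congr1 (fun w : 'rV_ _ => w 0 (widen_ord (ltnW ltmn) j)) vB; rewrite !mxE => vBj.
  rewrite -[RHS]vBj; apply: eq_bigr => i _; rewrite !mxE.
  rewrite insubT => [|ltj]; first exact: (ltn_ord j).
  by rewrite /=; congr (_ * _); congr (A _ _); apply: val_inj.
have lastB i : B i ord_max = 0 by rewrite mxE insubF //= ltnNge -ltnS ltmn.
have annB p : horner_mx B p = 0 -> p = 0.
  elim/poly_ind: p => // p c IHp.
  rewrite rmorphD rmorphM /= horner_mx_X horner_mx_C => pB.
  have c0 : c = 0.
    have := congr1 (fun Z : 'M[k]_n.+1 => Z ord_max ord_max) pB.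
    rewrite !mxE eqxx mulr1n big1 ?add0r // => j _.
    by rewrite lastB mulr0.
  move: pB; rewrite c0 raddf0 addr0 => pB.
  rewrite IHp ?mul0r ?addr0 //; apply/row_matrixP => i; rewrite row0.
  by apply: injB; rewrite -row_mul -[X in row i X]/(horner_mx B p * B) pB row0.
have /eqP := annB _ (Cayley_Hamilton B).
by rewrite -size_poly_eq0 size_char_poly.
Qed.

Section OperatorPolynomial.
Variables (k : comNzRingType) (N : lmodType k).

Lemma operator_prod (f : {linear N -> N}) (s : seq k) (x : N) :
  \sum_(n < (size s).+1) (\prod_(c <- s) ('X - c%:P))`_n *: iter n f x =
  foldr (fun c y => f y - c *: y) x s.
Proof.
elim: s => [|c s IHs]; first by rewrite big_ord1 big_nil coef1 scale1r.
set Q := \prod_(_ <- s) _ in IHs.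
have szQ : size Q = (size s).+1 by exact: size_prod_XsubC.
rewrite big_cons -/Q /= -IHs linear_sum scaler_sumr.
transitivity (\sum_(n < (size s).+2) (('X * Q)`_n *: iter n f x - (c * Q`_n) *: iter n f x)).
  by apply: eq_bigr => n _; rewrite mulrBl coefB mul_polyC coefZ scalerBl.
rewrite sumrB; congr (_ - _).
  rewrite big_ord_recl coefXM scale0r add0r; apply: eq_bigr => n _.
  by rewrite coefXM /= linearZ.
rewrite big_ord_recr /= nth_default ?szQ // mulr0 scale0r addr0.
by apply: eq_bigr => n _; rewrite scalerA.
Qed.

Lemma foldr_scale (f g : N -> N) (a : k) (s : seq k) (x : N) :
    (forall y, g y = a *: f y) -> (forall b y, f (b *: y) = b *: f y) ->
  foldr (fun c y => g y - c *: y) x [seq a * c | c <- s] =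
  a ^+ size s *: foldr (fun c y => f y - c *: y) x s.
Proof.
move=> gE fZ; elim: s => [|c s IHs] /=; first by rewrite expr0 scale1r.
by rewrite IHs gE fZ !scalerBr !scalerA exprS -mulrA [c * _]mulrC mulrA.
Qed.

End OperatorPolynomial.

(** * Reflections on two copies of the algebra *)

Section AlgebraModule.
Variables (k : comNzRingType) (A : algebra k).

(** The ring underlying an [algebra] comes without a module structure over the
    scalars; this copy of it carries the one given by [alg_scale]. *)
Definition alg_module : Type := A.
HB.instance Definition _ := GRing.Zmodule.on alg_module.

Fact alg_scaleA a b (x : alg_module) :
  alg_scale (A := A) a (alg_scale (A := A) b x) = alg_scale (A := A) (a * b) x.
Proof. by rewrite /alg_scale rmorphM mulrA. Qed.
Fact alg_scale1 : left_id 1 (@alg_scale k A : k -> alg_module -> alg_module).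
Proof. by move=> x; rewrite /alg_scale rmorph1 mul1r. Qed.
Fact alg_scaleDr : right_distributive (@alg_scale k A : k -> alg_module -> alg_module) +%R.
Proof. by move=> a x y; exact: mulrDr. Qed.
Fact alg_scaleDl (x : alg_module) :
  {morph (@alg_scale k A)^~ x : a b / a + b >-> (a + b : alg_module)}.
Proof. by move=> a b; rewrite /alg_scale rmorphD; exact: mulrDl. Qed.

HB.instance Definition _ := GRing.Zmodule_isLmodule.Build k alg_module
  alg_scaleA alg_scale1 alg_scaleDr alg_scaleDl.

Definition mull (h : A) (x : alg_module) : alg_module := h * (x : A).

Fact mull_linear h : linear (mull h).
Proof.
move=> a x y; rewrite /mull -[a *: x]/(alg_scale (A := A) a x).
rewrite -[RHS]/(alg_scale (A := A) a (h * (x : A)) + h * (y : A)) mulrDr.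
by rewrite /alg_scale !mulrA alg_scalarC.
Qed.

HB.instance Definition _ h := GRing.isLinear.Build k alg_module alg_module
  *:%R (mull h) (mull_linear h).

Lemma mull_sub h a x : mull h x - a *: x = mull (h - alg_scalar A a) x.
Proof. by apply/esym; exact: mulrBl. Qed.

Lemma mullM h h' x : mull h (mull h' x) = mull (h * h') x.
Proof. exact: mulrA. Qed.

Lemma mullB h (x y : alg_module) : mull h (x - y) = mull h x - mull h y.
Proof. exact: mulrBr. Qed.

Lemma mullZ h a x : mull h (a *: x) = a *: mull h x.
Proof. exact: linearZZ. Qed.

Lemma mull_conj (a b h : A) (s : seq k) x : b * a = 1 -> a * b = 1 ->
  foldr (fun c y => mull (a * h * b) y - c *: y) x s =
  mull a (foldr (fun c y => mull h y - c *: y) (mull b x) s).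
Proof.
move=> ba ab; elim: s => [|c s IHs] /=; first by rewrite mullM ab /mull mul1r.
rewrite IHs; move: (foldr _ _ _) => z.
by rewrite mullB mullZ (mullM (_ * _) a) (mullM a h) -(mulrA (a * h)) ba mulr1.
Qed.

(** The product of the factors X - c has an invertible constant term, so its
    value at h, which is 0, exhibits an inverse of h. *)
Lemma mull_invertible (h : A) (s : seq k) : (forall c, c \in s -> unital c) ->
    foldr (fun c y => mull h y - c *: y) (1 : A) s = 0 ->
  exists h', h * h' = 1 /\ h' * h = 1.
Proof.
move=> us; rewrite -operator_prod; set Q := \prod_(_ <- s) _ => Qh.
have [b Qb] : unital Q`_0.
  rewrite /Q; elim: s us {Q Qh} => [|c s IHs] us.
    by rewrite big_nil coef1; exact: unital1.
  rewrite big_cons coef0M coefB coefX coefC sub0r; apply: unitalM.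
    by apply/unitalN/us; rewrite mem_head.
  by apply: IHs => c' c's; apply: us; rewrite inE c's orbT.
pose Z : alg_module := \sum_(n < size s) Q`_n.+1 *: iter n (mull h) (1 : A).
pose one : alg_module := (1 : A).
have hZ : Q`_0 *: one + mull h Z = 0.
  rewrite -[RHS]Qh big_ord_recl /Z linear_sum; congr (_ + _).
  by apply: eq_bigr => n _; rewrite linearZ.
have Zh : (Z : A) * h = h * (Z : A).
  rewrite /Z mulr_suml mulr_sumr; apply: eq_bigr => n _.
  rewrite -[_ *: _]/(alg_scalar A _ * _) -mulrA [RHS]mulrA -alg_scalarC -mulrA.
  congr (_ * _); elim: (n : nat) => [|n' IHn] /=; first by rewrite mul1r mulr1.
  by rewrite /mull -mulrA IHn.
exists (alg_scalar A (- b) * (Z : A)).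
have E : h * (alg_scalar A (- b) * (Z : A)) = 1.
  rewrite mulrA -alg_scalarC -mulrA.
  have -> : h * (Z : A) = - alg_scalar A Q`_0.
    by apply/eqP; rewrite -addr_eq0 addrC -[alg_scalar _ _]mulr1; apply/eqP.
  by rewrite mulrN -rmorphM -rmorphN mulNr opprK mulrC Qb rmorph1.
by split=> //; rewrite -[RHS]E -mulrA Zh !mulrA alg_scalarC.
Qed.

End AlgebraModule.

Section Gdaha.
Variables (k : comNzRingType) (m : nat) (d : 'I_m -> nat).
Variables (u : forall i, 'I_(d i) -> k) (q : k).
Hypothesis u_unital : forall i (j : 'I_(d i)), unital (u j).
Hypothesis q_unital : unital q.

Local Notation H := (gdaha u q).
Local Notation scal := (gdaha_scalar u q).
Local Notation free := (free_alg k m).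

Definition gen (l : 'I_m) : H := quot_proj (gdaha_rel u q) (free_gen k l).

Definition eigen l : seq k := [seq u j | j <- enum 'I_(d l)].

Lemma size_eigen l : size (eigen l) = d l.
Proof. by rewrite size_map size_enum_ord. Qed.

Lemma scal_quot a : scal a = quot_proj (gdaha_rel u q) (free_scalar m a).
Proof. by []. Qed.

Lemma quot_rel0 x : gdaha_rel u q x -> quot_proj (gdaha_rel u q) x = 0.
Proof.
move=> rx; rewrite -(rmorph0 (quot_proj (gdaha_rel u q))).
by apply/quot_ringP; rewrite subr0; exact: ideal_gen_in.
Qed.

Lemma gen_prod : \prod_i gen i = scal q.
Proof.
apply/eqP; rewrite -subr_eq0 scal_quot -rmorph_prod -rmorphB.
by apply/eqP/quot_rel0; right.
Qed.

Lemma gen_eigen_prod l : \prod_(j < d l) (gen l - scal (u j)) = 0.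
Proof.
transitivity (quot_proj (gdaha_rel u q)
    (\prod_(j < d l) (free_gen k l - free_scalar m (u j)))).
  rewrite rmorph_prod; apply: eq_bigr => j _.
  exact: (esym (rmorphB (quot_proj (gdaha_rel u q)) _ _)).
by apply: quot_rel0; left; exists l.
Qed.

Lemma gen_eigen l (x : alg_module H) :
  foldr (fun c y => mull (gen l) y - c *: y) x (eigen l) = 0.
Proof.
transitivity (mull (A := H) (\prod_(j <- enum 'I_(d l)) (gen l - scal (u j))) x).
  rewrite /eigen; elim: (enum _) => [|j s IHs] /=; first by rewrite big_nil /mull mul1r.
  rewrite big_cons IHs (mull_sub (A := H) (gen l) (u j)).
  exact: (mullM (A := H)).
have -> : \prod_(j <- enum 'I_(d l)) (gen l - scal (u j)) = 0.
  by rewrite -[RHS](gen_eigen_prod l) enumT [index_enum _]unlock.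
exact: mul0r.
Qed.

Lemma gen_invertible l : exists h, gen l * h = 1 /\ h * gen l = 1.
Proof.
apply: (@mull_invertible k H (gen l) (eigen l)); last exact: gen_eigen.
by move=> c /mapP[j _ ->].
Qed.

Definition gen_nat n : H := oapp gen 1 (insub n).
(** With g_n the product of the first n generators, each generator is a ratio
    g_l^-1 g_{l+1}. This makes room for the reflections: s_l acts from the even
    to the odd copy of the algebra by g_l, and back by its inverse. *)
Definition gprod n : H := \prod_(0 <= j < n) gen_nat j.
Definition gprodV n : H := xget 0 [set h | gprod n * h = 1 /\ h * gprod n = 1]%classic.

Lemma gprod0 : gprod 0 = 1.
Proof. by rewrite /gprod big_geq. Qed.

Lemma gprodS (l : 'I_m) : gprod l.+1 = gprod l * gen l.
Proof. by rewrite /gprod big_nat_recr //= /gen_nat valK. Qed.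

Lemma gprod_last : gprod m = scal q.
Proof.
rewrite -gen_prod /gprod big_mkord; apply: eq_bigr => l _.
by rewrite /gen_nat valK.
Qed.

Lemma gprodVP n : gprod n * gprodV n = 1 /\ gprodV n * gprod n = 1.
Proof.
suff : exists h, [set h | gprod n * h = 1 /\ h * gprod n = 1]%classic h.
  exact: xgetPex.
rewrite /gprod /=; elim: n => [|n [h [h1 h2]]].
  by exists 1; rewrite big_geq // mulr1.
have [h' [h1' h2']] : exists h', gen_nat n * h' = 1 /\ h' * gen_nat n = 1.
  rewrite /gen_nat; case: insub => [l|] /=; first exact: gen_invertible.
  by exists 1; rewrite mulr1.
exists (h' * h); rewrite big_nat_recr //=; split.
  by rewrite mulrA -(mulrA _ _ h') h1' mulr1.
by rewrite mulrA -(mulrA h') h2 mulr1.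
Qed.

(** The walls are in cyclic order but g_m = q, not 1: the last generator is q
    s_m s_1, and its eigenvalues are those of a rotation multiplied by q. *)
Definition closing (l : 'I_m) : k := if l.+1 == m then q else 1.

Lemma closing_unital l : unital (closing l).
Proof. by rewrite /closing; case: ifP => _ //; exact: unital1. Qed.

Lemma gprodV_ordS (l : 'I_m) :
  gprodV l * gprod (ordS l) = scal (partial_inv (closing l)) * gen l.
Proof.
have [g1 g2] := gprodVP l.
have E : gprodV l * gprod l.+1 = gen l by rewrite gprodS mulrA g2 mul1r.
have := partial_invP (closing_unital l); rewrite /closing; case: eqP => lm qq.
  have -> : ordS l = 0%N :> nat by rewrite /= lm modnn.
  rewrite gprod0 mulr1 -E lm gprod_last.
  by rewrite -gdaha_scalarC mulrA -rmorphM mulrC qq rmorph1 mul1r.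
have -> : ordS l = l.+1 :> nat.
  by rewrite /= modn_small // ltn_neqAle ltn_ord andbT; apply/eqP.
by rewrite E -[partial_inv 1]mul1r qq rmorph1 mul1r.
Qed.

Definition weights l : seq k := [seq partial_inv (closing l) * c | c <- eigen l].
Definition weight_poly l : {poly k} := \prod_(c <- weights l) ('X - c%:P).

Lemma size_weights l : size (weights l) = d l.
Proof. by rewrite size_map size_eigen. Qed.

Lemma weight_poly_top l : (weight_poly l)`_(d l) = 1.
Proof.
have := monicP (monic_prod_XsubC (weights l) xpredT id).
by rewrite /lead_coef size_prod_XsubC size_weights.
Qed.

Lemma weight_poly_bottom l : unital (weight_poly l)`_0.
Proof.
rewrite /weight_poly; have : forall c, c \in weights l -> unital c.
  move=> c /mapP[_ /mapP[j _ ->] ->]; apply: unitalM => //.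
  exact/unital_inv/closing_unital.
elim: (weights l) => [|c s IHs] us; first by rewrite big_nil coef1; exact: unital1.
rewrite big_cons coef0M coefB coefX coefC sub0r; apply: unitalM.
  by apply/unitalN/us; rewrite mem_head.
by apply: IHs => c' c's; apply: us; rewrite inE c's orbT.
Qed.

Definition gop (p : bool) (i : 'I_m) : alg_module H -> alg_module H :=
  mull (A := H) (if p then gprodV i else gprod i).

Lemma gop_linear p i : linear (gop p i).
Proof. exact: mull_linear. Qed.

Lemma gopK p i x : gop (~~ p) i (gop p i x) = x.
Proof.
by rewrite /gop mullM; case: p; rewrite /= ?(gprodVP i).1 ?(gprodVP i).2 /mull mul1r.
Qed.

(** The rotation is multiplication by T_l, divided by [closing], on the even
    copy, and by a conjugate of it on the odd copy; the same polynomial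
    annihilates both. *)
Lemma gop_relation p l x : dihedral_relation d weight_poly gop p l x = 0.
Proof.
rewrite (relation_iter _ _ gopK); move: (balanced _ _ _ _ _ _) (p (+) _) => {}x {}p.
have [r r_eq rP] : exists2 t : H, rotate gop p l = mull (A := H) t &
    forall x, foldr (fun c y => mull t y - c *: y) x (weights l) = 0.
  have tP y : foldr (fun c y => mull (gprodV l * gprod (ordS l) : H) y - c *: y) y
                    (weights l) = 0.
    rewrite gprodV_ordS /weights (@foldr_scale _ _ (mull (gen l))) => [|z|b z].
    - by rewrite gen_eigen scaler0.
    - exact: (esym (mullM (A := H) _ _ _)).
    - exact: linearZ.
  case: p; last first.
    by exists (gprodV l * gprod (ordS l)) => //; apply: funext => y; exact: mullM.
  exists (gprod (ordS l) * (gprodV l * gprod (ordS l)) * gprodV (ordS l)).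
    apply: funext => y; rewrite /rotate /gop /= mullM.
    by rewrite -!mulrA (gprodVP _).1 mulr1.
  move=> y; have [g1 g2] := gprodVP (ordS l).
  by rewrite (mull_conj (A := H) _ _ _ g2 g1) tP linear0.
rewrite r_eq -[RHS](rP x) -operator_prod size_weights.
by [].
Qed.

End Gdaha.

(** * A basis of the algebra *)

Lemma lextU (k : comNzRingType) (K : choiceType) (N : lmodType k)
    (f : K -> N) (w : K) (a : k) : lext f (mkmalgU w a) = a *: f w.
Proof. by rewrite (lextEw _ msuppU_le) big_seq_fset1 mcoeffUU. Qed.

Section FreeAction.
Variables (k : comNzRingType) (m : nat) (N : lmodType k).
Variable t : 'I_m -> {linear N -> N}.
Local Notation free := (free_alg k m).

Definition apply_word (s : seq 'I_m) (y : N) : N := foldr (fun l => t l) y s.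

Definition free_act (x : free) (y : N) : N :=
  lext (fun w : fmonom 'I_m => apply_word w y) x.

Lemma apply_word_linear s : linear (apply_word s).
Proof.
elim: s => // l s IHs a x y.
have E z : apply_word (l :: s) z = t l (apply_word s z) by [].
by rewrite !E IHs linearP.
Qed.

HB.instance Definition _ s :=
  GRing.isLinear.Build k N N *:%R (apply_word s) (apply_word_linear s).

Lemma free_act0 y : free_act 0 y = 0.
Proof. exact: linear0. Qed.
Lemma free_actD x x' y : free_act (x + x') y = free_act x y + free_act x' y.
Proof. exact: linearD. Qed.
Lemma free_actB x x' y : free_act (x - x') y = free_act x y - free_act x' y.
Proof. exact: linearB. Qed.

Lemma free_act_linear x : linear (free_act x).
Proof.
move=> a y z; rewrite /free_act /lext scaler_sumr -big_split; apply: eq_bigr => w _.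
by rewrite linearP scalerDr !scalerA mulrC.
Qed.

HB.instance Definition _ x :=
  GRing.isLinear.Build k N N *:%R (free_act x) (free_act_linear x).

Lemma free_act_scalar a y : free_act (free_scalar m a) y = a *: y.
Proof. by rewrite /free_act lextU fm1. Qed.

Lemma free_act1 y : free_act 1 y = y.
Proof. by rewrite -[1](rmorph1 (free_scalar m)) free_act_scalar scale1r. Qed.

Lemma free_act_gen l y : free_act (free_gen k l) y = t l y.
Proof. by rewrite /free_act lextU fmU scale1r. Qed.

Lemma free_actM x x' y : free_act (x * x') y = free_act x (free_act x' y).
Proof.
transitivity (free_act (fgmul x x') y); first by [].
rewrite /fgmul {1}/free_act linear_sum; apply: eq_bigr => w _.
rewrite linear_sum (_ : free_act x' y =
    \sum_(w' <- msupp x') mcoeff w' x' *: apply_word w' y) //.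
rewrite linear_sum scaler_sumr; apply: eq_bigr => w' _.
rewrite /= lextU linearZ scalerA; congr (_ *: _).
by rewrite /apply_word fmM foldr_cat.
Qed.

End FreeAction.

Section BasisTheorem.
Variables (k : comNzRingType) (m : nat) (d : 'I_m -> nat) (W : alcoves d).
Variables (u : forall i, 'I_(d i) -> k) (q : k).
Hypothesis u_unital : forall i (j : 'I_(d i)), unital (u j).
Hypothesis q_unital : unital q.
Hypothesis m_gt0 : (0 < m)%N.

Local Notation H := (gdaha u q).
Local Notation scal := (gdaha_scalar u q).
Local Notation free := (free_alg k m).
Local Notation M := (malg W k).
Local Notation e := (@basis_vector k W).
Local Notation P := (weight_poly u q).
Local Notation op := (@op k m d W P).
Local Notation opp := (fun (_ : bool) i => lext (op i)).
Let Ptop := @weight_poly_top k m d u q.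
Let Pbot := @weight_poly_bottom k m d u q u_unital q_unital.
Let K i y : lext (op i) (lext (op i) y) = y := opK Ptop Pbot i y.

Definition rotation (l : 'I_m) (y : M) : M := lext (op l) (lext (op (ordS l)) y).
(** The action of T_l on the even part of the free module. *)
Definition twist (l : 'I_m) (y : M) : M := closing q l *: rotation l y.

Fact rotation_linear l : linear (rotation l).
Proof. by move=> a x y; rewrite /rotation !linearP. Qed.
HB.instance Definition _ l :=
  GRing.isLinear.Build k M M *:%R (rotation l) (rotation_linear l).
Fact twist_linear l : linear (twist l).
Proof. by move=> a x y; rewrite /twist linearP scalerDr !scalerA mulrC. Qed.
HB.instance Definition _ l :=
  GRing.isLinear.Build k M M *:%R (twist l) (twist_linear l).

Local Notation act := (free_act (fun l => twist l)).

Lemma homogeneous_op p i (y : M) : homogeneous p y -> homogeneous (~~ p) (lext (op i) y).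
Proof.
move=> hy v; apply: contra_neq_eq => nv.
apply: (lext_ind (S := fun z => mcoeff v z = 0)) => [||a x|w wy].
- exact: mcoeff0.
- by move=> x z x0 z0; rewrite mcoeffD x0 z0 addr0.
- by move=> x0; rewrite mcoeffZ x0 mulr0.
have bw : low (len w).+2 (e w) by apply: low_basis; rewrite /below; lia.
have := op_low Ptop Pbot i bw; rewrite lext_basis; apply.
by rewrite /below -(hy w wy) in nv *; apply: contra nv => /andP[_]; rewrite /= negbK.
Qed.

Lemma homogeneous_op2 p i j (y : M) : homogeneous p y ->
  homogeneous p (lext (op i) (lext (op j) y)).
Proof. by move=> hy; rewrite -[p]negbK; do 2!apply: homogeneous_op. Qed.

Lemma homogeneousD p (x y : M) : homogeneous p x -> homogeneous p y -> homogeneous p (x + y).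
Proof.
move=> hx hy w; apply: contra_neq_eq => nw; rewrite mcoeffD.
have -> : mcoeff w x = 0 by apply: contra_neq_eq nw => /hx.
by rewrite add0r; apply: contra_neq_eq nw => /hy.
Qed.

Lemma homogeneousZ p a (x : M) : homogeneous p x -> homogeneous p (a *: x).
Proof.
move=> hx w; apply: contra_neq_eq => nw; rewrite mcoeffZ.
by have -> : mcoeff w x = 0; [apply: contra_neq_eq nw => /hx|rewrite mulr0].
Qed.

Lemma homogeneous0 p : homogeneous p (0 : M).
Proof. by move=> w; rewrite mcoeff0 eqxx. Qed.

Lemma homogeneous_act p x (y : M) : homogeneous p y -> homogeneous p (act x y).
Proof.
move=> hy; apply: lext_ind => [||a z|w _]; first exact: homogeneous0.
- by move=> *; exact: homogeneousD.
- exact: homogeneousZ.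
elim: (w : seq _) => //= l s IHs; apply: homogeneousZ.
exact: homogeneous_op2.
Qed.

Lemma chain_surjective p r l n (y : M) : homogeneous (p (+) odd n) y ->
  exists2 x, homogeneous p x & chain opp p r l n x = y.
Proof.
elim: n y => [|n IHn] y hy; first by exists y; rewrite ?addbF // in hy.
have [|x hx xy] := IHn (lext (op (letter (r (+) odd n) l)) y).
  have -> : p (+) odd n = ~~ (p (+) odd n.+1) by rewrite /= addbN negbK.
  exact: homogeneous_op.
by exists x => //=; rewrite xy K.
Qed.

Lemma rotation_eigen l y : homogeneous false y ->
  foldr (fun c z => rotation l z - c *: z) y (weights u q l) = 0.
Proof.
move=> hy; rewrite -operator_prod size_weights.
have hy' : homogeneous (odd (d l) (+) odd (d l)) y by rewrite addbb.
have [x hx xy] := chain_surjective (~~ odd (d l)) l hy'.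
have := op_relation Ptop Pbot l hx.
rewrite (relation_iter _ _ (fun _ => K)) addbb.
rewrite /balanced double0 subn0 (order_gt0 W l) xy => rel.
by rewrite -[RHS]rel.
Qed.

Lemma eigen_weights l : eigen u l = [seq closing q l * c | c <- weights u q l].
Proof.
rewrite /weights -map_comp -[LHS]map_id; apply: eq_map => c /=.
by rewrite mulrA partial_invP ?mul1r //; exact: closing_unital.
Qed.

Lemma act_eigen l y : homogeneous false y ->
  act (\prod_(j < d l) (free_gen k l - free_scalar m (u j))) y = 0.
Proof.
move=> hy; transitivity (foldr (fun c z => twist l z - c *: z) y (eigen u l)).
  have -> : \prod_(j < d l) (free_gen k l - free_scalar m (u j)) =
      \prod_(j <- enum 'I_(d l)) (free_gen k l - free_scalar m (u j)).
    by rewrite enumT [index_enum _]unlock.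
  rewrite /eigen; elim: (enum _) => [|j s IHs]; first by rewrite big_nil free_act1.
  by rewrite big_cons free_actM IHs free_actB free_act_gen free_act_scalar.
rewrite eigen_weights (@foldr_scale _ _ (rotation l)) // => [|b z].
  by rewrite rotation_eigen // scaler0.
exact: linearZ.
Qed.

Definition free_gprod n : free :=
  \prod_(0 <= j < n) oapp (@free_gen k m) 1 (insub j).

Let o0 : 'I_m := Ordinal m_gt0.

Lemma act_gprod_recr (l : 'I_m) y :
  act (free_gprod l.+1) y = act (free_gprod l) (twist l y).
Proof.
rewrite /free_gprod (big_nat_recr _ _ _ (leq0n l)) [X in act (_ * X)](_ : _ = free_gen k l).
  by rewrite free_actM free_act_gen.
by rewrite /= valK.
Qed.

Lemma act_gprod (l : 'I_m) y :
  act (free_gprod l) y = lext (op o0) (lext (op l) y).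
Proof.
case: l => n ltn /=; elim: n ltn y => [|n IHn] ltn y.
  rewrite /free_gprod big_geq // free_act1.
  by rewrite (_ : Ordinal ltn = o0) ?K //; apply: val_inj.
have clE : closing q (Ordinal (ltnW ltn)) = 1 by rewrite /closing ltn_eqF.
rewrite (act_gprod_recr (Ordinal (ltnW ltn))) (IHn (ltnW ltn)) /twist clE.
rewrite scale1r /rotation K; congr (lext (op o0) (lext (op _) _)).
by apply: val_inj; rewrite /= modn_small.
Qed.

Lemma act_gprod_last y : act (free_gprod m) y = q *: y.
Proof.
have lt : (m.-1 < m)%N by rewrite prednK.
have mE : m = (Ordinal lt).+1 by rewrite /= prednK.
rewrite [X in free_gprod X]mE (act_gprod_recr (Ordinal lt)) (act_gprod (Ordinal lt)).
have clE : closing q (Ordinal lt) = q by rewrite /closing /= prednK // eqxx.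
rewrite /twist clE !linearZ /= /rotation K.
rewrite (_ : ordS _ = o0) ?K //; apply: val_inj => /=.
by rewrite prednK // modnn.
Qed.

(** The eigenvalue relations vanish on even vectors by [op_relation], and the
    product relation because the reflections telescope. On odd vectors the
    operators s_l s_{l+1} satisfy other equations: there it is s_{l+1} s_l that
    P_l annihilates. *)
Lemma act_rel x y : homogeneous false y -> ideal_gen (gdaha_rel u q) x ->
  act x y = 0.
Proof.
move=> hy I; elim: I y hy => {x} [x [[l ->]|->]||x x' _ IH _ IH'|a x _ IH|a x _ IH] y hy.
- exact: act_eigen.
- have -> : \prod_i free_gen k i = free_gprod m.
    by rewrite /free_gprod big_mkord; apply: eq_bigr => i _; rewrite valK.
  by rewrite free_actB free_act_scalar act_gprod_last subrr.
- exact: free_act0.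
- by rewrite free_actD IH ?IH' ?addr0.
- by rewrite free_actM IH // linear0.
- by rewrite free_actM IH //; exact: homogeneous_act.
Qed.

(** Independent of the representative on even vectors only. *)
Definition gdaha_act (h : H) (y : M) : M :=
  act (repr (h : quot_ring (gdaha_rel u q))) y.

Lemma gdaha_act_proj (x : free) y : homogeneous false y ->
  gdaha_act (quot_proj (gdaha_rel u q) x) y = act x y.
Proof.
move=> hy; apply/eqP; rewrite -subr_eq0 -free_actB; apply/eqP/act_rel => //.
exact: quot_repr.
Qed.

Lemma gdaha_projE (h : H) : exists x : free, h = quot_proj (gdaha_rel u q) x.
Proof. by exists (repr (h : quot_ring (gdaha_rel u q))); rewrite /quot_proj reprK. Qed.

Lemma homogeneous_gdaha_act h p y : homogeneous p y -> homogeneous p (gdaha_act h y).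
Proof. exact: homogeneous_act. Qed.

Local Notation act_h := gdaha_act.

Lemma gdaha_actM (h h' : H) y : homogeneous false y ->
  act_h (h * h' : H) y = act_h h (act_h h' y).
Proof.
have [x ->] := gdaha_projE h; have [x' ->] := gdaha_projE h' => hy.
rewrite -[X in act_h X](rmorphM (quot_proj (gdaha_rel u q))) !gdaha_act_proj //.
  exact: free_actM.
exact: homogeneous_act.
Qed.

Lemma gdaha_actD (h h' : H) y : homogeneous false y ->
  act_h (h + h' : H) y = act_h h y + act_h h' y.
Proof.
have [x ->] := gdaha_projE h; have [x' ->] := gdaha_projE h' => hy.
rewrite -[X in act_h X](rmorphD (quot_proj (gdaha_rel u q))) !gdaha_act_proj //.
exact: free_actD.
Qed.

Lemma gdaha_act_scal a y : homogeneous false y -> act_h (scal a) y = a *: y.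
Proof. by move=> hy; rewrite gdaha_act_proj // free_act_scalar. Qed.

Lemma gdaha_act1 y : homogeneous false y -> act_h 1 y = y.
Proof.
by move=> hy; rewrite -[X in act_h X](rmorph1 scal) gdaha_act_scal // scale1r.
Qed.

Lemma gdaha_act_sum n (c : 'I_n -> k) (v : 'I_n -> H) y : homogeneous false y ->
  act_h (\sum_i alg_scale (c i) (v i)) y = \sum_i c i *: act_h (v i) y.
Proof.
move=> hy; apply: (big_rec2 (fun h z => act_h h y = z)).
  by rewrite -[X in act_h X](rmorph0 scal) gdaha_act_scal // scale0r.
move=> i z h _ <-; rewrite gdaha_actD // gdaha_actM // gdaha_act_scal //.
exact: homogeneous_gdaha_act.
Qed.

Lemma gdaha_act_gprod (l : 'I_m) y : homogeneous false y ->
  act_h (gprod u q l) y = lext (op o0) (lext (op l) y).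
Proof.
move=> hy; rewrite -act_gprod -(gdaha_act_proj _ hy) /gprod /free_gprod.
rewrite [in RHS]rmorph_prod; congr (act_h _ _); apply: eq_bigr => j _.
by rewrite /gen_nat; case: insub => [i|] //=; rewrite rmorph1.
Qed.

Lemma gdaha_act_gprodV (l : 'I_m) y : homogeneous false y ->
  act_h (gprodV u q l) y = lext (op l) (lext (op o0) y).
Proof.
move=> hy; have hy' : homogeneous false (lext (op l) (lext (op o0) y)).
  exact: homogeneous_op2.
rewrite -{1}(K o0 y) -{1}(K l (lext (op o0) y)) -gdaha_act_gprod //.
rewrite -gdaha_actM // (gprodVP q u_unital l).2.
exact: gdaha_act1.
Qed.

Local Notation wd := (word (W := W) (gop (d := d) (u := u) (q := q)) (1 : H)).

Lemma homogeneous_basis w : homogeneous (odd (len w)) (e w).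
Proof. by move=> v; rewrite mcoeff_basis; have [->|_] := eqVneq w v; rewrite ?eqxx. Qed.

Lemma even_ind (S : W -> Prop) : S (base W) ->
    (forall w i j, ~~ odd (len w) -> pref w = Some i -> pref (refl i w) = Some j ->
       ~~ odd (len (refl j (refl i w))) -> len w = (len (refl j (refl i w))).+2 ->
       S (refl j (refl i w)) -> S w) ->
  forall w, ~~ odd (len w) -> S w.
Proof.
move=> S0 S2 w; elim: (len w).+1 {-2}w (ltnSn (len w)) => // {}n IHn {}w lt ew.
case Ei: (pref w) => [i|]; last by rewrite (prefN Ei).
case Ej: (pref (refl i w)) => [j|]; last first.
  by move: ew; rewrite (len_pref Ei) (prefN Ej) len_base.
have lw : len w = (len (refl j (refl i w))).+2.
  by rewrite (len_pref Ei) (len_pref Ej).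
have ew' : ~~ odd (len (refl j (refl i w))) by rewrite lw /= negbK in ew.
by apply: (S2 w i j) => //; apply: IHn => //; move: lt; rewrite lw; lia.
Qed.

Lemma word_step w i j : ~~ odd (len w) -> pref w = Some i ->
  pref (refl i w) = Some j ->
  wd w = (gprodV u q i * gprod u q j) * (wd (refl j (refl i w)) : H) :> H.
Proof.
move=> ew Ei Ej; rewrite (wordE _ _ Ei) (wordE _ _ Ej).
rewrite !odd_len (negbTE ew) /= /gop.
exact: (mullM (A := H)).
Qed.

(** The word of w only uses preferred edges, where the operators have no
    correction terms. *)
Lemma gdaha_act_word w : ~~ odd (len w) -> act_h (wd w) (e (base W)) = e w.
Proof.
have hb : homogeneous false (e (base W)).
  by have := @homogeneous_basis (base W); rewrite len_base.
elim/even_ind: w / => [|w i j ew Ei Ej ew' _ IH].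
  by rewrite word_base gdaha_act1.
have hw : homogeneous false (e (refl j (refl i w))).
  by have := @homogeneous_basis (refl j (refl i w)); rewrite (negbTE ew').
rewrite (word_step ew Ei Ej) gdaha_actM // IH gdaha_actM //.
rewrite gdaha_act_gprod // gdaha_act_gprodV.
  rewrite K lext_basis op_preferred ?reflK; last by rewrite /preferred_edge reflK Ej eqxx orbT.
  by rewrite lext_basis op_preferred ?reflK // /preferred_edge reflK Ei eqxx orbT.
exact: homogeneous_op2.
Qed.

Lemma words_lin_indep n (w : 'I_n -> W) : injective w ->
  (forall i, ~~ odd (len (w i))) -> lin_indep (fun i => wd (w i) : H).
Proof.
move=> injw ew c; set s := \sum_i _ => s0 i.
have hb : homogeneous false (e (base W)).
  by have := @homogeneous_basis (base W); rewrite len_base.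
have : act_h s (e (base W)) = 0.
  by rewrite s0 -[X in act_h X](rmorph0 scal) gdaha_act_scal // scale0r.
rewrite gdaha_act_sum // => /(congr1 (mcoeff (w i))).
rewrite mcoeff0 raddf_sum (bigD1 i) //= big1 => [|j ji].
  by rewrite gdaha_act_word // mcoeffZ mcoeff_basis eqxx mulr1 addr0.
rewrite gdaha_act_word // mcoeffZ mcoeff_basis.
by rewrite (inj_eq injw) (negbTE ji) mulr0.
Qed.

(** All the products s_i s_j, so that the reduced words of length 2n are
    products of n elements of a finite set. *)
Definition pair_gens : seq H :=
  [seq (gprodV u q i * gprod u q j : H) | i : 'I_m <- enum 'I_m, j : 'I_m <- enum 'I_m].

Lemma word_filt_span w n : ~~ odd (len w) -> (len w <= n.*2)%N ->
  filt_span pair_gens n (wd w : H).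
Proof.
move=> ew lw; have [s [ss sub ->]] : exists s : seq H,
    [/\ (size s <= n)%N, {subset s <= pair_gens} & wd w = \prod_(y <- s) y :> H].
  elim/even_ind: w / ew n lw => [|w i j ew Ei Ej ew' lwE IH] n lw.
    by exists [::]; split=> //; rewrite big_nil word_base.
  case: n lw => [|n] lw; first by rewrite lwE in lw.
  have [|s [ss sub sE]] := IH n; first by move: lw; rewrite lwE doubleS.
  exists ((gprodV u q i * gprod u q j : H) :: s); split=> [//|y|].
    rewrite inE => /predU1P[->|/sub//].
    by apply: allpairs_f; rewrite mem_enum.
  by rewrite big_cons (word_step ew Ei Ej) sE.
exists 1%N, (fun=> 1), (fun=> \prod_(y <- s) y); split.
  by move=> _; exists s.
by rewrite big_ord1 /alg_scale rmorph1 mul1r.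
Qed.

(** The words of length at most 2n span this submodule; describing it through
    the free module gives access to the triangularity of the operators. *)
Definition filtration n (h : H) := exists2 y : M, low n.*2.+2 y & h = lext wd y.

Lemma low_even_homogeneous n (y : M) : low n.*2.+2 y -> homogeneous false y.
Proof.
by move=> ly w /(low_supp ly)/andP[_ /eqP ->]; rewrite /= negbK odd_double.
Qed.

Lemma filtration_le n n' h : (n <= n')%N -> filtration n h -> filtration n' h.
Proof.
move=> le [y ly ->]; exists y => //; apply: low_le ly; first by lia.
by rewrite /= !negbK !odd_double.
Qed.

Lemma filtrationD n h h' : filtration n h -> filtration n h' -> filtration n (h + h').
Proof.
move=> [y ly ->] [y' ly' ->]; exists (y + y'); first exact: lowD.
exact: (esym (linearD (lext wd) y y')).
Qed.

Lemma filtration0 n : filtration n 0.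
Proof. by exists 0; [exact: low0|exact: (esym (linear0 (lext wd)))]. Qed.

Lemma filtrationZ n a h : filtration n h -> filtration n (alg_scale a h).
Proof.
move=> [y ly ->]; exists (a *: y); first exact: lowZ.
exact: (esym (linearZZ (lext wd) a y)).
Qed.

Lemma filtration1 : filtration 0 1.
Proof.
exists (e (base W)); last by rewrite lext_basis word_base.
by apply: low_basis; rewrite /below len_base.
Qed.

Lemma filtration_gen l n h : filtration n h -> filtration n.+1 (gen u q l * h).
Proof.
move=> [y ly ->]; have hy := low_even_homogeneous ly.
have gl := gop_linear (u := u) (q := q).
have gK := gopK u_unital (q := q).
have gR := gop_relation u_unital q_unital.
have ext := @intertwine_op k m d W P Ptop Pbot _ _ gl gK gR (1 : H).
exists (closing q l *: lext (op l) (lext (op (ordS l)) y)).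
  by apply: lowZ; rewrite doubleS; do 2!apply: (op_low Ptop Pbot).
rewrite linearZ /= (ext true) ?(ext false) //; last first.
  by rewrite -[true]/(~~ false); exact: homogeneous_op.
rewrite /gop /= (mullM (A := H)) (gprodV_ordS u_unital q_unital) /mull.
rewrite -[RHS]/(alg_scale (A := H) (closing q l) _) /alg_scale !mulrA -rmorphM.
by rewrite partial_invP ?rmorph1 ?mul1r //; exact: closing_unital.
Qed.

Lemma filtration_mul (h : H) :
  exists c, forall n h', filtration n h' -> filtration (n + c) (h * h').
Proof.
have [x ->] := gdaha_projE h.
pose S (z : free) := exists c, forall n h', filtration n h' ->
  filtration (n + c) ((quot_proj (gdaha_rel u q) z : H) * h').
rewrite -/(S x) [x]malg_basisE; apply: (lext_ind (S := S)) => [|y z|a z|w _].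
- by exists 0%N => n h' _; rewrite rmorph0 mul0r; exact: filtration0.
- move=> [c Sc] [c' Sc']; exists (maxn c c') => n h' fh'.
  rewrite rmorphD mulrDl; apply: filtrationD.
    by apply: filtration_le (Sc _ _ fh'); rewrite leq_add2l leq_maxl.
  by apply: filtration_le (Sc' _ _ fh'); rewrite leq_add2l leq_maxr.
- move=> [c Sc]; exists c => n h' fh'.
  rewrite (_ : a *: z = free_scalar m a * z); last exact: (esym (mul_malgC a z)).
  by rewrite rmorphM -mulrA; exact: (filtrationZ a (Sc n h' fh')).
case: w => s; elim: s => [|l s [c Sc]].
  exists 0%N => n h' fh'; rewrite addn0.
  have -> : basis_vector k (FMonom [::]) = 1 :> free.
    by rewrite -[RHS](rmorph1 (free_scalar m)) /basis_vector -(fmoneE 'I_m).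
  by rewrite rmorph1 mul1r.
exists c.+1 => n h' fh'.
have -> : basis_vector k (FMonom (l :: s)) = free_gen k l * basis_vector k (FMonom s) :> free.
  rewrite [RHS]fgmulUU mulr1 /basis_vector; congr (mkmalgU _ 1).
  by apply/eqP; rewrite fmP fmM fmU.
rewrite rmorphM -mulrA addnS; apply: filtration_gen; exact: Sc.
Qed.

Lemma filt_span_filtration (s : seq H) : exists c, forall n h,
  filt_span s n h -> filtration (n * c) h.
Proof.
have [c sc] : exists c, forall n y h', y \in s -> filtration n h' ->
    filtration (n + c) (y * h').
  elim: s => [|y s [c sc]]; first by exists 0%N.
  have [c' yc'] := filtration_mul y; exists (maxn c c') => n z h'.
  rewrite inE => /predU1P[->|zs] fh'.
    by apply: filtration_le (yc' _ _ fh'); rewrite leq_add2l leq_maxr.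
  by apply: filtration_le (sc _ _ _ zs fh'); rewrite leq_add2l leq_maxl.
exists c => n h [b [a [v [vP ->]]]].
apply: (big_ind (filtration (n * c))) => [|x y|i _].
- exact: filtration0.
- exact: filtrationD.
apply: filtrationZ; have [w [ws sub ->]] := vP i.
apply: (@filtration_le (size w * c)); first by rewrite leq_mul2r ws orbT.
elim: w sub {ws} => [|y w IHw] sub; first by rewrite big_nil; exact: filtration1.
rewrite big_cons /= mulSn addnC; apply: sc; first by apply: sub; rewrite mem_head.
by apply: IHw => z zw; apply: sub; rewrite inE zw orbT.
Qed.

End BasisTheorem.

(** * Growth *)

Section Counting.
Variables (m : nat) (d : 'I_m -> nat) (W : alcoves d).

(** The lengths of N^2 points of the grid are O(N). At least half of these
    alcoves have the same parity, and a reflection makes odd ones even. *)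
Lemma even_alcoves (i0 : 'I_m) : exists2 c, (0 < c)%N & forall N, (0 < N)%N ->
  exists s : seq W, [/\ uniq s, (N ^ 2 <= 2 * size s)%N &
      forall w, w \in s -> ~~ odd (len w) /\ (len w <= c * N)%N].
Proof.
exists (3 * margin W).+1 => // N N0.
pose L := [seq grid W p | p <- [seq (a, b) | a <- iota 0 N, b <- iota 0 N]].
have szL : size L = (N ^ 2)%N by rewrite size_map size_allpairs !size_iota.
have uL : uniq L.
  rewrite map_inj_uniq; last exact: grid_inj.
  by apply: allpairs_uniq; rewrite ?iota_uniq // => -[a b] [a' b'].
have lenL w : w \in L -> (len w <= margin W * (2 * N + 1))%N.
  case/mapP => p /allpairsP[[a b] [/=]]; rewrite !mem_iota !add0n => la lb -> ->.
  apply: leq_trans (len_gauge _) _; apply: leq_trans (gauge_grid _ _ _) _.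
  by rewrite leq_mul2l; apply/orP; right; lia.
have szE : (size [seq w <- L | odd (len w)] + size [seq w <- L | ~~ odd (len w)] = N ^ 2)%N.
  by rewrite !size_filter -szL; exact: (count_predC (fun w => odd (len w))).
have [le|lt] := leqP (size [seq w <- L | odd (len w)]) (size [seq w <- L | ~~ odd (len w)]).
  exists [seq w <- L | ~~ odd (len w)]; split; first exact: filter_uniq.
    by rewrite -szE; lia.
  by move=> w; rewrite mem_filter => /andP[-> /lenL lw]; split=> //; nia.
exists [seq refl i0 w | w <- [seq w <- L | odd (len w)]]; split.
- rewrite map_inj_uniq ?filter_uniq //; exact: (can_inj (@reflK _ _ W i0)).
- by rewrite size_map -szE; lia.
move=> w' /mapP[w]; rewrite mem_filter => /andP[ow /lenL lw] ->.
rewrite odd_len ow; split=> //; apply: leq_trans (len_refl_le _ _) _; nia.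
Qed.

End Counting.

Section Rank.
Variables (R : realType) (k : comNzRingType) (A : algebra k).

Lemma lin_indep_leq n p (b : 'I_p -> A) (v : 'I_n -> A) :
    (forall i, exists c : 'I_p -> k, v i = \sum_j alg_scale (c j) (b j)) ->
  lin_indep v -> (n <= p)%N.
Proof.
move=> /choice[c vE] indep; apply: (@row_injective_leq k _ _ (\matrix_(i, j) c i j)).
move=> x xc; apply/rowP => i; rewrite mxE; apply: indep i.
transitivity (\sum_j alg_scale ((x *m (\matrix_(i, j) c i j)) 0 j) (b j)); last first.
  by rewrite xc big1 // => j _; rewrite mxE /alg_scale rmorph0 mul0r.
under eq_bigr => i _ do rewrite vE /alg_scale mulr_sumr.
rewrite exchange_big; apply: eq_bigr => j _.
rewrite mxE /alg_scale rmorph_sum mulr_suml; apply: eq_bigr => i _.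
by rewrite mxE rmorphM mulrA.
Qed.

Lemma rank_le (N : set A) p :
  (forall n (v : 'I_n -> A), (forall i, N (v i)) -> lin_indep v -> (n <= p)%N) ->
  (rank R N <= p%:R%:E)%E.
Proof.
move=> le; apply: ge_ereal_sup => _ [n [v [Nv iv]] <-].
by rewrite lee_fin ler_nat; exact: le Nv iv.
Qed.

Lemma rank_ge (N : set A) n (v : 'I_n -> A) :
  (forall i, N (v i)) -> lin_indep v -> (n%:R%:E <= rank R N)%E.
Proof. by move=> Nv iv; apply: ereal_sup_ubound; exists n => //; exists v. Qed.

Lemma rank_ge0 (N : set A) : (0 <= rank R N)%E.
Proof.
apply: (@rank_ge N 0 (fun=> 0)) => [[]//|c _ []//].
Qed.

End Rank.

Section GrowthExponent.
Variables (R : realType) (r : nat -> \bar R).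
Local Notation growth := (limn_esup (fun n => lne (r n) * ((ln n%:R)^-1)%:E)%E).

Lemma ln_nat_large (c : R) (e : R) : 0 < e ->
  exists N : nat, forall n, (N <= n)%N -> 0 < ln (n%:R : R) /\ c <= e * ln n%:R.
Proof.
move=> e0; pose x := expR (`|c| / e + 1).
have x1 : 1 < x by rewrite expR_gt1 ltr_wpDl ?ltr01 // divr_ge0 // ltW.
exists (Num.truncn x).+1 => n Nn.
have xn : x < n%:R.
  by apply: lt_le_trans (truncnS_gt x) _; rewrite ler_nat.
have lnn : `|c| / e + 1 < ln n%:R.
  rewrite -ltr_expR lnK // posrE; apply: lt_trans xn; exact: expR_gt0.
have ce : 0 <= `|c| / e by rewrite divr_ge0 // ltW.
split; first by apply: lt_trans lnn; rewrite ltr_wpDl.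
apply: le_trans (ler_norm c) _; rewrite mulrC -ler_pdivrMr //.
by apply: le_trans (ltW lnn); rewrite lerDl.
Qed.

Lemma growth_le K : (forall n, 0 <= r n)%E ->
  (forall n, (0 < n)%N -> (r n <= (K * n ^ 2)%:R%:E)%E) -> (growth <= 2%:E)%E.
Proof.
move=> r0 rK; apply/lee_addgt0Pr => e e0.
have [N NP] := ln_nat_large (ln (K.+1%:R : R)) e0.
apply: (@le_trans _ _ (ereal_sup
   ((fun n : nat => lne (r n) * ((ln n%:R)^-1)%:E)%E @` [set n : nat | (N.+1 <= n)%N])%classic)).
  by apply: ereal_inf_lbound; exists [set n : nat | (N.+1 <= n)%N]%classic => //; exists N.+1.
apply: ge_ereal_sup => _ [n /= Nn <-].
have n0 : (0 < n)%N by exact: leq_trans Nn.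
have [ln0 le] := NP n (ltnW Nn).
have p1 : 0 < K.+1%:R :> R by rewrite ltr0n.
have p2 : 0 < n%:R :> R by rewrite ltr0n.
have lner : (lne (r n) <= (ln K.+1%:R + 2 * ln n%:R)%:E)%E.
  rewrite -[2 * _]mulrC mulr_natr -lnXn // -lnM ?posrE ?exprn_gt0 //.
  rewrite -lne_EFin ?mulr_gt0 ?exprn_gt0 // lee_lne ?in_itv /= ?leey ?andbT //.
    apply: le_trans (rK n n0) _; rewrite lee_fin natrM natrX.
    by rewrite ler_wpM2r ?exprn_ge0 ?ler_nat // ltW.
apply: (@le_trans _ _ ((ln K.+1%:R + 2 * ln n%:R)%:E * ((ln n%:R)^-1)%:E)%E).
  by apply: lee_wpmul2r => //; rewrite lee_fin invr_ge0 ltW.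
by rewrite -EFinM -EFinD lee_fin ler_pdivrMr //; lra.
Qed.

Lemma growth_ge K n0 :
  (forall n, (n0 <= n)%N -> exists2 a : nat, (n ^ 2 <= K * a)%N & (a%:R%:E <= r n)%E) ->
  (2%:E <= growth)%E.
Proof.
move=> rK; apply/lee_subgt0Pr => e e0.
have [N NP] := ln_nat_large (ln (K.+1%:R : R)) e0.
apply: le_ereal_inf_tmp => _ [V [N' _ VN'] <-].
pose n := (maxn N (maxn n0 N')).+1.
have Vn : V n by apply: VN'; rewrite /= /n; lia.
apply: le_trans (ereal_sup_ubound _); last by exists n; [exact: Vn|reflexivity].
have [|a na ra] := rK n; first by rewrite /n; lia.
have [|ln0 le] := NP n; first by rewrite /n; lia.
have np : 0 < n%:R :> R by rewrite ltr0n.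
have p1 : 0 < K.+1%:R :> R by rewrite ltr0n.
have a0 : 0 < a%:R :> R.
  by rewrite ltr0n; move: na; rewrite /n; case: (a) => // ; rewrite muln0.
have lnra : ((ln (a%:R : R))%:E <= lne (r n))%E.
  rewrite -lne_EFin // lee_lne ?in_itv /= ?leey ?andbT // ?lee_fin ?ltW //.
  by apply: lt_le_trans ra; rewrite lte_fin.
apply: (@le_trans _ _ ((ln (a%:R : R))%:E * ((ln n%:R)^-1)%:E)%E); last first.
  by apply: lee_wpmul2r => //; rewrite lee_fin invr_ge0 ltW.
have : 2 * ln n%:R <= ln K.+1%:R + ln a%:R :> R.
  rewrite -[2 * _]mulrC mulr_natr -lnXn // -lnM ?posrE //.
  rewrite ler_ln ?posrE ?exprn_gt0 ?mulr_gt0 //.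
  by rewrite -natrX -natrM ler_nat; apply: leq_trans na _; rewrite leq_mul2r leqnSn orbT.
move=> le2; rewrite -EFinB -EFinM lee_fin ler_pdivlMr //; lra.
Qed.

End GrowthExponent.

Section Dimension.
Variables (R : realType) (k : comNzRingType) (m : nat) (d : 'I_m -> nat).
Variables (W : alcoves d) (u : forall i, 'I_(d i) -> k) (q : k).
Hypothesis u_unital : forall i (j : 'I_(d i)), unital (u j).
Hypothesis q_unital : unital q.
Hypothesis m_gt0 : (0 < m)%N.
Local Notation H := (gdaha u q).
Local Notation wd := (word (W := W) (gop (d := d) (u := u) (q := q)) (1 : H)).

(** Alcoves of length at most 2n have their coordinates in an interval of length
    O(n). *)
Lemma filtration_span n :
  exists b : 'I_((2 * (gauge (base W) + margin W * (2 * n).+1)).+1 ^ 2) -> H,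
  forall h : H, filtration W n h -> exists c, h = \sum_j alg_scale (c j) (b j).
Proof.
move BE : (gauge (base W) + margin W * (2 * n).+1)%N => B.
have gB (w : W) : (len w <= n.*2)%N -> (gauge w + margin W <= B)%N.
  move=> lw; apply: (@leq_trans (gauge (base W) + margin W * len w + margin W)%N).
    by rewrite leq_add2r gauge_len.
  by rewrite -BE mulnS -addnA [(margin W + _)%N]addnC !leq_add2l leq_add2r leq_mul2l mul2n lw orbT.
move LE : (2 * B).+1 => L.
pose I : finType := ('I_L * 'I_L)%type.
have cardI : #|I| = (L ^ 2)%N by rewrite card_prod card_ord mulnn.
pose alcove_at (i : I) (w : W) := pos w = ((i.1 : nat)%:Z - B%:Z, (i.2 : nat)%:Z - B%:Z).
pose b (i : I) : H := if pselect (exists w, alcove_at i w) is left ex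
  then wd (projT1 (cid ex)) else 0.
have bE i w : alcove_at i w -> b i = wd w.
  move=> iw; rewrite /b; case: pselect => [ex|]; last by case; exists w.
  case: (cid ex) => w' /= iw'; have -> // : w' = w.
  by apply: pos_inj; rewrite iw iw'.
have locate w : (len w <= n.*2)%N -> exists i, alcove_at i w.
  move=> lw; have [p1 p2] := pos_gauge w; have gw := gB w lw.
  have i1 : (absz ((pos w).1 + B%:Z)%R < L)%N by clear -p1 gw LE; lia.
  have i2 : (absz ((pos w).2 + B%:Z)%R < L)%N by clear -p2 gw LE; lia.
  exists (Ordinal i1, Ordinal i2); rewrite /alcove_at [LHS]surjective_pairing /=.
  by congr pair; clear -p1 p2 gw; lia.
exists (fun j => b (enum_val (cast_ord (esym cardI) j))) => h [y ly ->].
apply: (lext_ind (N := alg_module H) (S := fun h : alg_module H => exists c : 'I_(L ^ 2) -> k,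
   h = \sum_j alg_scale (c j) (b (enum_val (cast_ord (esym cardI) j))))).
- by exists (fun=> 0); rewrite big1 // => j _; rewrite /alg_scale rmorph0 mul0r.
- move=> x z [c ->] [c' ->]; exists (fun j => c j + c' j).
  rewrite -[LHS]big_split; apply: eq_bigr => j _.
  by rewrite /alg_scale rmorphD mulrDl.
- move=> a x [c ->]; exists (fun j => a * c j).
  rewrite -[LHS]/(alg_scale (A := H) a _) /alg_scale mulr_sumr; apply: eq_bigr => j _.
  by rewrite rmorphM mulrA.
move=> w /(low_supp ly)/below_lt lw.
have [|i iw] := locate w; first by lia.
exists (fun j => (j == cast_ord cardI (enum_rank i))%:R).
rewrite (bigD1 (cast_ord cardI (enum_rank i))) //= big1 => [|j ji].
  rewrite eqxx /alg_scale rmorph1 mul1r addr0 cast_ord_comp cast_ord_id enum_rankK.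
  by rewrite (bE _ _ iw).
by rewrite (negbTE ji) /alg_scale rmorph0 mul0r.
Qed.

Lemma rank_filt_le (s : seq H) : exists K, forall n, (0 < n)%N ->
  (rank R (filt_span s n) <= (K * n ^ 2)%:R%:E)%E.
Proof.
have [c sc] := filt_span_filtration W u_unital q_unital m_gt0 s.
exists ((2 * (gauge (base W) + margin W * (2 * c).+1)).+1 ^ 2)%N => n n0.
apply: rank_le => p v vs indep; have [b bP] := filtration_span (n * c).
apply: leq_trans (lin_indep_leq (b := b) _ indep) _.
  by move=> i; apply: bP; exact: sc.
rewrite -expnMn leq_exp2r //; nia.
Qed.

Lemma rank_filt_ge : exists K n0, forall n, (n0 <= n)%N -> exists2 a : nat,
  (n ^ 2 <= K * a)%N & (a%:R%:E <= rank R (filt_span (pair_gens u q) n))%E.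
Proof.
have [c c0 even] := even_alcoves W (Ordinal m_gt0).
exists (2 * (2 * c) ^ 2)%N, c => n cn.
have N0 : (0 < n %/ c)%N by rewrite divn_gt0.
have [s [us ss sP]] := even _ N0.
exists (size s).
  apply: (@leq_trans ((2 * c * (n %/ c)) ^ 2)).
    by rewrite leq_exp2r //; have := ltn_ceil n c0; nia.
  by rewrite expnMn [(2 * (2 * c) ^ 2)%N]mulnC -mulnA leq_mul2l ss orbT.
pose w (i : 'I_(size s)) := nth (base W) s i.
have ws i : w i \in s by exact: mem_nth.
apply: (@rank_ge R k H _ _ (fun i => wd (w i))).
  move=> i; have [ew lw] := sP _ (ws i); apply: word_filt_span => //.
  by apply: leq_trans lw _; have := leq_divM n c; nia.
apply: (words_lin_indep u_unital q_unital m_gt0) => [i j /eqP|i].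
  by rewrite nth_uniq // => /eqP/val_inj.
by have [] := sP _ (ws i).
Qed.

Theorem GKdim_gdaha : GKdim R H = 2%:E.
Proof.
apply/eqP; rewrite eq_le; apply/andP; split.
  apply: ge_ereal_sup => _ [s _ <-]; have [K rK] := rank_filt_le s.
  by apply: growth_le rK => n; exact: rank_ge0.
apply: le_trans (ereal_sup_ubound _); last by exists (pair_gens u q).
by have [K [n0 rK]] := rank_filt_ge; exact: growth_ge rK.
Qed.

End Dimension.

(** * The alcoves of the four affine reflection groups *)

Section Coordinates.
Variables (m : nat) (d : 'I_m -> nat).
Variables (wall : nat -> int * int -> int) (mirror : nat -> int * int -> int * int).
Variables (regular_point : pred (int * int)) (extent : int * int -> nat) (bound h : nat).
Local Notation alt := (alternate (fun i : 'I_m => mirror i)).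
Hypothesis mirror_regular : forall (i : 'I_m) p, regular_point p -> regular_point (mirror i p).
Hypothesis mirrorK : forall i : 'I_m, involutive (mirror i).
Hypothesis wall_mirror : forall (i : 'I_m) p, wall i (mirror i p) = - wall i p.
Hypothesis wall_neq0 : forall (i : 'I_m) p, regular_point p -> wall i p != 0.
Hypothesis chamber : forall p, regular_point p -> (forall i : 'I_m, 0 < wall i p) -> p = (1, 1).
Hypothesis size_mirror : forall (i : 'I_m) p, wall i p < 0 ->
  (extent (mirror i p) < extent p <= extent (mirror i p) + bound)%N.
Hypothesis wall_adj : forall (i j : 'I_m) p, i != j -> wall i p < 0 -> wall j p < 0 ->
  (j == ordS i) || (i == ordS j).
Hypothesis wall_two : forall (j l : 'I_m) p, wall l p < 0 -> wall (ordS l) p < 0 ->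
  wall j p < 0 -> (j == l) || (j == ordS l).
Hypothesis wall_up : forall (l : 'I_m) p, 0 < wall l p -> 0 < wall (ordS l) p ->
  forall r n, (n < d l)%N -> 0 < wall (letter (r (+) odd n) l) (alt r l n p).
Hypothesis wall_down : forall (l : 'I_m) p, wall l p < 0 -> wall (ordS l) p < 0 ->
  forall r n, (n < d l)%N -> wall (letter (r (+) odd n) l) (alt r l n p) < 0.
Hypothesis mirror_braid : forall (l : 'I_m) p, alt true l (d l) p = alt false l (d l) p.
Hypothesis d_gt0 : forall l, (0 < d l)%N.
Hypothesis m_gt2 : (2 < m)%N.
Hypothesis size_ge : forall p, (`|p.1| <= extent p + bound)%N /\ (`|p.2| <= extent p + bound)%N.
Hypothesis h_gt0 : (0 < h)%N.
Let point (ab : nat * nat) : int * int := (1 + (h * ab.1)%:Z, 1 + (h * ab.2)%:Z).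
Hypothesis point_regular : forall ab, regular_point (point ab).
Hypothesis size_point : forall ab, (extent (point ab) <= bound * (ab.1 + ab.2 + 1))%N.

Let W : choiceType := {p : int * int | regular_point p}.
Let base : W := exist _ (point (0, 0)) (point_regular (0, 0)).
Let refl (i : 'I_m) (w : W) : W := exist _ (mirror i (val w)) (mirror_regular i (valP w)).
Let desc (i : 'I_m) (w : W) := wall i (val w) < 0.
Let grid (ab : nat * nat) : W := exist _ (point ab) (point_regular ab).

Let val_alternate r l n (w : W) : val (alternate refl r l n w) = alt r l n (val w).
Proof. by elim: n => //= n ->. Qed.

Let ascE i w : ~~ desc i w = (0 < wall i (val w)).
Proof. by rewrite /desc -leNgt le_eqVlt eq_sym (negbTE (wall_neq0 i (valP w))). Qed.

Fact alcoves_ordS_neq (l : 'I_m) : (ordS l == l) = false.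
Proof.
apply/negP => /eqP/(congr1 val) /=; have := ltn_ord l.
have [/eqP e|lt] := boolP (l.+1 == m); first by rewrite e modnn; lia.
by move=> ltm; rewrite modn_small; lia.
Qed.

Fact alcoves_ordSS_neq (l : 'I_m) : (ordS (ordS l) == l) = false.
Proof.
apply/negP => /eqP/(congr1 val) /=; have := ltn_ord l.
have [/eqP e|lt] := boolP (l.+1 == m).
  by rewrite e modnn modn_small; lia.
move=> ltm; rewrite [(l.+1 %% m)%N]modn_small; last by lia.
have [/eqP e|lt'] := boolP (l.+2 == m); first by rewrite e modnn; lia.
by rewrite modn_small; lia.
Qed.

Definition alcoves_of_coordinates : alcoves d.
Proof.
refine (@Alcoves m d W base refl desc (fun w => extent (val w)) bound _ _ _ _ _ _ _ _ _ d_gt0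
  alcoves_ordS_neq alcoves_ordSS_neq val val_inj (fun w => size_ge (val w)) grid _
  (fun a b => size_point (a, b))).
- by move=> i w; apply: val_inj; exact: mirrorK.
- move=> i w; rewrite ascE /desc /= wall_mirror oppr_lt0.
  by [].
- move=> w nd; apply: val_inj; rewrite /= (chamber (valP w)) /point /= ?muln0 //.
  by move=> i; rewrite -ascE.
- by move=> i w; exact: size_mirror.
- by move=> i j w; exact: wall_adj.
- by move=> j l w; exact: wall_two.
- move=> l w; rewrite !ascE => l0 l1 r n nd.
  by rewrite ascE val_alternate; exact: wall_up.
- by move=> l w l0 l1 r n nd; rewrite /desc val_alternate; exact: wall_down.
- move=> l r w; apply: val_inj; rewrite !val_alternate.
  by case: r; rewrite /= mirror_braid.
- move=> [a b] [a' b'] e.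
  have e1 := congr1 (fun w : W => (val w).1) e.
  have e2 := congr1 (fun w : W => (val w).2) e.
  have {}e1 : (h * a = h * a')%N by move: e1; rewrite /grid /point /=; lia.
  have {}e2 : (h * b = h * b')%N by move: e2; rewrite /grid /point /=; lia.
  by congr pair; apply/eqP; rewrite -(eqn_pmul2l h_gt0) ?e1 ?e2.
Defined.

End Coordinates.

(** The positive roots of the finite reflection group, as linear forms in the
    coordinates given by its simple roots. An alcove is represented by the point
    inside it where no root takes a value divisible by the Coxeter number h; in
    the fundamental alcove this point is (1, 1). *)
Definition roots (D : diagram) (p : int * int) : seq int :=
  let: (x, z) := p in
  match D with
  | D4 => [:: x; z]
  | E6 => [:: x; z; x + z]
  | E7 => [:: x; z; x + z; x + 2 * z]
  | E8 => [:: x; z; x + z; 2 * x + z; 3 * x + z; 3 * x + 2 * z]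
  end.

Definition coxeter (D : diagram) : nat :=
  match D with D4 => 2 | E6 => 3 | E7 => 4 | E8 => 6 end.

(** The simple roots, and h minus the highest roots. *)
Definition wall (D : diagram) (i : nat) (p : int * int) : int :=
  let: (x, z) := p in
  match D, i with
  | D4, 0 => x | D4, 1 => z | D4, 2 => 2 - x | D4, _ => 2 - z
  | E6, 0 => x | E6, 1 => 3 - x - z | E6, _ => z
  | E7, 0 => x | E7, 1 => 4 - x - 2 * z | E7, _ => z
  | E8, 0 => x | E8, 1 => 6 - 3 * x - 2 * z | E8, _ => z
  end.

Definition mirror (D : diagram) (i : nat) (p : int * int) : int * int :=
  let: (x, z) := p in
  match D, i with
  | D4, 0 => (- x, z) | D4, 1 => (x, - z) | D4, 2 => (4 - x, z) | D4, _ => (x, 4 - z)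
  | E6, 0 => (- x, x + z) | E6, 1 => (3 - z, 3 - x) | E6, _ => (x + z, - z)
  | E7, 0 => (- x, x + z) | E7, 1 => (x, 4 - x - z) | E7, _ => (x + 2 * z, - z)
  | E8, 0 => (- x, 3 * x + z) | E8, 1 => (x, 6 - 3 * x - z) | E8, _ => (x + z, - z)
  end.

Definition regular_point (D : diagram) (p : int * int) : bool :=
  all (fun v => ~~ ((coxeter D)%:Z %| v)%Z) (roots D p).

(** For each root v, the distance from v to the middle of the strip 0 < v < h of
    the fundamental alcove. The reflection in a wall permutes these distances
    except for the root of that wall, whose distance decreases when the point
    moves to the side of the fundamental alcove. Like the length, the sum thus
    decreases along descents, and it is visibly comparable with the coordinates.
    *)
Definition spread (D : diagram) (p : int * int) : nat :=
  sumn [seq absz (2 * v - (coxeter D)%:Z)%R | v <- roots D p].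

Ltac case_leg := let lt := fresh "lt" in
  move=> [[|[|[|[|?]]]] lt] //.

Definition diagram_alcoves (D : diagram) : alcoves (@leg D).
Proof.
(* 400 exceeds the jumps 2h of the spread and the slope of its growth along
   the grid for each of the four root systems *)
apply: (@alcoves_of_coordinates _ _ (wall D) (mirror D) (regular_point D)
          (spread D) 400 (coxeter D)).
- by case: D; case_leg; move=> [x z]; rewrite /regular_point /=; lia.
- by case: D; case_leg; move=> [x z]; rewrite /=; congr pair; lia.
- by case: D; case_leg; move=> [x z]; rewrite /=; lia.
- by case: D; case_leg; move=> [x z]; rewrite /regular_point /=; lia.
- move=> [x z] reg pos; have p0 : forall n (lt : (n < nlegs D)%N), 0 < wall D n (x, z).
    by move=> n lt; exact: (pos (Ordinal lt)).
  case: D reg {pos} p0 => reg p0;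
  have := p0 0%N isT; have := p0 1%N isT; have := p0 2 isT; try have := p0 3 isT;
  move: reg; rewrite /regular_point /=; clear; move=> *; congr pair; lia.
- by case: D; case_leg; move=> [x z]; rewrite /spread /=; lia.
- by case: D; case_leg; case_leg; move=> [x z]; rewrite /=; lia.
- by case: D; case_leg; case_leg; move=> [x z]; rewrite /=; lia.
- case: D; case_leg; move=> [x z] p0 p1 [] [|[|[|[|[|[|?]]]]]] // _;
    move: p0 p1; rewrite /letter /=; lia.
- case: D; case_leg; move=> [x z] p0 p1 [] [|[|[|[|[|[|?]]]]]] // _;
    move: p0 p1; rewrite /letter /=; lia.
- by case: D; case_leg; move=> [x z]; rewrite /=; congr pair; lia.
- by case: D; case_leg.
- by case: D.
- by case: D => -[x z]; rewrite /spread /=; lia.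
- by case: D.
- by case: D => -[a b]; rewrite /regular_point /=; lia.
- by case: D => -[a b]; rewrite /spread /=; lia.
Defined.

(** * Specialization to the torus *)

Section Units.
Variables (R : realType) (D : diagram).
Local Notation C := R[i].

Lemma unital_field (K : fieldType) (x : K) : x != 0 -> unital x.
Proof. by move=> x0; exists x^-1; rewrite mulfV. Qed.

Lemma root_of_leg_neq0 (i : 'I_(nlegs D)) (j : 'I_(leg i)) : root_of_leg R j != 0.
Proof.
rewrite /root_of_leg /expi; set x := (_ / _); apply/eqP => -[c0 s0].
by have := cos2Dsin2 x; rewrite c0 s0 expr0n addr0 => /eqP; rewrite eq_sym oner_eq0.
Qed.

Lemma coord_cst_unital (c : C) : c != 0 -> unital (coord_cst D c : coord_ring R D).
Proof.
move=> c0; exists (coord_cst D c^-1); apply: val_inj; apply: funext => t.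
by rewrite /= -[LHS]/(c * c^-1) mulfV.
Qed.

(** Its inverse is the product of the other coordinates on the same leg. *)
Lemma coord_fun_unital (i : 'I_(nlegs D)) (j : 'I_(leg i)) :
  unital (coord_fun R j : coord_ring R D).
Proof.
exists (\prod_(j' < leg i | j' != j) coord_fun R j').
rewrite -[RHS](_ : \prod_(j' < leg i) coord_fun R j' = 1); first by rewrite [RHS](bigD1 j).
apply: val_inj; rewrite rmorph_prod; apply: funext => t.
rewrite -[RHS](tcoord_prod t i) fct_prodE.
by [].
Qed.

End Units.

Theorem corollary5p2 (R : realType) (D : diagram) (q : R[i]) (hq : q != 0)
    (t : torus R D) :
  GKdim R (bfH D q) = 2%:E /\ GKdim R (H t q) = 2%:E.
Proof.
have legs_gt0 : (0 < nlegs D)%N by case: (D).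
split; apply: (GKdim_gdaha R (diagram_alcoves D)) => //.
- move=> i j; apply: unitalM; last exact: coord_fun_unital.
  by apply: coord_cst_unital; exact: root_of_leg_neq0.
- exact: coord_cst_unital.
- move=> i j; apply: unital_field; rewrite mulf_neq0 ?tcoord_neq0 //.
  exact: root_of_leg_neq0.
- exact: unital_field.
Qed.
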